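(* Let $q>0$. Let $\mu(dx)=\phi(x)dx$ be a Borel probability measure on $\mathbb{R}^d$, with $\phi$ even and $\hat\phi$ positive and integrable. Let $h:\mathbb{R}^d\to\mathbb{R}$ be a continuous positive definite function. Let $n\in\mathbb{N}$, let $X_1,\ldots,X_n$ be i.i.d. random vectors distributed according to $\mu$, and consider the function $H:[0,+\infty)^n\to[0,+\infty]$ (the functional associated to $h$) defined as $$H(a):=\mathbb{E}\,h\left(a_1^{1/q}X_1+\cdots+a_n^{1/q}X_n\right).$$ Then: 1) If for each $t\in\mathbb{R}^d$ the function $[0,+\infty)\ni r\mapsto\hat\phi(r^{1/q}t)$ is log-convex, then $H$ is log-convex. Conversely, if for each continuous positive definite function $h$ on $\mathbb{R}^d$ the associated functional $H$ is log-convex, then for each $t\in\mathbb{R}^d$ the function $[0,+\infty)\ni r\mapsto\hat\phi(r^{1/q}t)$ is log-convex. 2) If for each $t\in\mathbb{R}^d$ the function $[0,+\infty)\ni r\mapsto\hat\phi(r^{1/q}t)$ is log-concave, then $H$ is Schur concave. Conversely, if for each continuous positive definite function $h$ on $\mathbb{R}^d$ the associated functional $H$ is Schur concave, and in addition $[0,\infty)\ni r\mapsto\hat\phi(r^{1/q}t)$ is continuous for each $t\in\mathbb{R}^d$, then for each $t\in\mathbb{R}^d$ the function $[0,\infty)\ni r\mapsto\hat\phi(r^{1/q}t)$ is log-concave.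
   Context: Fourier transform convention: $\hat f(x)=\int_{\mathbb{R}^d}f(y)e^{-2\pi i\langle x,y\rangle}dy$; ''positive'' means $\ge0$. A function $h:\mathbb{R}^d\to\mathbb{R}$ is positive definite if for all $k\in\mathbb{N}$ and $x_1,\ldots,x_k\in\mathbb{R}^d$ the matrix $(h(x_i-x_j))_{i,j}$ is positive semi-definite. A function $f:C\to[0,\infty)$ on a convex set $C$ is log-convex (resp. log-concave) if $f(\lambda x+(1-\lambda)y)\le f(x)^\lambda f(y)^{1-\lambda}$ (resp. $\ge$) for all $x,y\in C$, $\lambda\in(0,1)$. For $x,y\in\mathbb{R}^n$, write $x\prec y$ if, after rearranging the coordinates of each in decreasing order, $x_1+\cdots+x_i\le y_1+\cdots+y_i$ for $i=1,\ldots,n-1$ and $x_1+\cdots+x_n=y_1+\cdots+y_n$. A function $f$ is Schur concave if $x\prec y$ implies $f(x)\ge f(y)$ for all $x,y$ in its domain.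
   Formalization: In the converse of part 2 it is assumed that n ≥ 2: for n = 1 every H is trivially Schur concave, and the converse fails, e.g. for the Gaussian density with q = 4, where the ray function exp(-π√r|t|²) is continuous but not log-concave. *)

(* Defs.v *)
From HB Require Import structures.
From mathcomp Require Import all_boot all_order all_algebra.
From mathcomp Require Import all_classical all_reals all_analysis.
From mathcomp Require Import complex.

Set Implicit Arguments.
Unset Strict Implicit.
Unset Printing Implicit Defensive.

Import Order.TTheory GRing.Theory Num.Theory.
Import numFieldNormedType.Exports.

Local Open Scope classical_set_scope.
Local Open Scope ring_scope.

(* Vectors of R^d are row vectors 'rV[R]_d with the library's topology; the
   measurable sets are the Borel sets of that topology. *)
HB.instance Definition _ (R : realType) (m n : nat) :=
  Measurable.copy 'M[R]_(m, n) (g_sigma_algebraType (@open 'M[R]_(m, n))).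

Section borel_matrix.
Context {R : realType}.

Lemma measurable_coord (m n : nat) (i : 'I_m) (j : 'I_n) :
  measurable_fun [set: 'M[R]_(m, n)] (fun A : 'M[R]_(m, n) => A i j).
Proof.
apply: (measurability _ (measurable_realfun.RGenOpens.measurableE R)).
move=> _ [_ [a [b ->]] <-]; rewrite setTI; apply: sub_sigma_algebra.
move/continuousP : (@coord_continuous R m n i j); apply.
exact: interval_open.
Qed.

Lemma measurable_fun_coordP d (T : measurableType d) (m n : nat)
    (f : T -> 'M[R]_(m, n)) :
  (forall i j, measurable_fun setT (fun t => f t i j)) ->
  measurable_fun setT f.
Proof.
move=> mf.
apply: (@measurability _ _ _ _ _ _ (@open 'M[R]_(m, n))) => //.
move=> _ [U oU <-]; rewrite setTI.
pose box (p : 'M[rat]_(m, n) * rat) : set 'M[R]_(m, n) :=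
  [set A | forall i j, ball (ratr (p.1 i j) : R) (ratr p.2) (A i j)].
have mbox p : measurable (f @^-1` box p).
  have -> : f @^-1` box p = \bigcap_(ij in [set: 'I_m * 'I_n])
      ((fun t => f t ij.1 ij.2) @^-1` ball (ratr (p.1 ij.1 ij.2) : R) (ratr p.2)).
    by apply/seteqP; split=> t /= h => [[i j] _|i j]; [exact: h|exact: (h (i, j))].
  apply: fin_bigcap_measurable => //.
  move=> -[i j] _ /=; rewrite -[X in measurable X]setTI.
  by apply: mf => //; rewrite ball_itv; exact: measurable_itv.
suff -> : f @^-1` U = \bigcup_p
    (if `[< box p `<=` U >] then f @^-1` box p else set0).
  apply: countable_bigcupT_measurable => // p; case: ifP => // _.
apply/seteqP; split=> t /=; last first.
  by case=> p _; case: ifPn => // /asboolP; apply.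
move=> Uft; have [e /= e0 eU] := (@nbhs_ballP R _ _ _).1 (open_nbhs_nbhs (conj oU Uft)).
have [r] := rat_in_itvoo (divr_gt0 e0 (ltr0Sn R 1)).
rewrite in_itv/= => /andP[r0 re].
have hA i j : {p : rat | `|ratr p - f t i j| < ratr r}.
  have lt : f t i j - ratr r < f t i j + ratr r by rewrite ltrD2l gtrN.
  have /cid[p] := rat_in_itvoo lt; rewrite in_itv/= => /andP[h1 h2].
  by exists p; rewrite ltr_distl h1 h2.
exists (\matrix_(i, j) sval (hA i j), r) => //.
case: ifPn => [_ i j|/asboolP]; rewrite /=.
  by rewrite mxE; exact: (svalP (hA i j)).
move=> h; exfalso; apply: h => B /= hB; apply: eU; split=> // i j.
have hp := svalP (hA i j); have := hB i j; rewrite mxE => hB'.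
rewrite /ball/= in hB' *; rewrite (splitr e) distrC in hp *.
apply: le_lt_trans (ler_distD (ratr (sval (hA i j))) _ _) _.
by apply: ltrD; [exact: lt_trans hp re|exact: lt_trans hB' re].
Qed.

End borel_matrix.

Section lebesgue_rV.
Context {R : realType}.

Section step.
Variables (d : nat) (m : {sigma_finite_measure set 'rV[R]_d -> \bar R}).

Definition rV_cons (p : measurableTypeR R * 'rV[R]_d) : 'rV[R]_(1 + d) :=
  row_mx (const_mx p.1) p.2.

Definition rV_uncons (v : 'rV[R]_(1 + d)) : measurableTypeR R * 'rV[R]_d :=
  (v ord0 ord0, rsubmx v).

Lemma rV_cons0 p : rV_cons p ord0 (ord0 : 'I_d.+1) = p.1.
Proof.
rewrite (_ : (ord0 : 'I_d.+1) = lshift d (ord0 : 'I_1)) /rV_cons; last exact: val_inj.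
by rewrite row_mxEl mxE.
Qed.

Lemma rV_consS p (i : 'I_d) : rV_cons p ord0 (lift (ord0 : 'I_d.+1) i) = p.2 ord0 i.
Proof.
rewrite (_ : lift (ord0 : 'I_d.+1) i = rshift 1 i) /rV_cons; last exact: val_inj.
by rewrite row_mxEr.
Qed.

Lemma rV_consK : cancel rV_cons rV_uncons.
Proof.
by case=> x v; rewrite /rV_uncons rV_cons0 /rV_cons row_mxKr.
Qed.

Lemma measurable_rV_cons : measurable_fun setT rV_cons.
Proof.
apply: measurable_fun_coordP => i j; rewrite (ord1 i) /rV_cons.
case: (split_ordP j) => k ->.
  by under eq_fun do rewrite row_mxEl mxE; exact: measurable_fst.
under eq_fun do rewrite row_mxEr.
exact: (measurableT_comp (@measurable_coord R 1 d ord0 k) measurable_snd).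
Qed.

Lemma measurable_rV_uncons : measurable_fun setT rV_uncons.
Proof.
apply/measurable_fun_pairP; split; first exact: measurable_coord.
apply: measurable_fun_coordP => i j.
by rewrite /rV_uncons/=; under eq_fun do rewrite mxE; exact: measurable_coord.
Qed.

Definition lebesgue_rV_step : set 'rV[R]_d.+1 -> \bar R :=
  pushforward (@lebesgue_measure R \x m)%E rV_cons.

Let step0 : lebesgue_rV_step set0 = 0%E.
Proof. by rewrite /lebesgue_rV_step /pushforward preimage_set0 measure0. Qed.

Let step_ge0 A : (0 <= lebesgue_rV_step A)%E.
Proof. by rewrite /lebesgue_rV_step /pushforward; exact: measure_ge0. Qed.

Let step_sigma_additive : semi_sigma_additive lebesgue_rV_step.
Proof.
exact: (@measure_semi_sigma_additive _ _ _
  (measure_function_pushforward__canonical__measure_function_Measure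
    (@lebesgue_measure R \x m)%E measurable_rV_cons)).
Qed.

HB.instance Definition _ := isMeasure.Build _ _ _ lebesgue_rV_step
  step0 step_ge0 step_sigma_additive.

Let step_sigma_finite : sigma_finite setT lebesgue_rV_step.
Proof.
have /sigma_finiteP[F [FT ndF Foo]] : sigma_finite setT (@lebesgue_measure R).
  exact: sigma_finiteT.
have /sigma_finiteP[G [GT ndG Goo]] := sigma_finiteT m.
exists (fun k => rV_uncons @^-1` (F k `*` G k)).
  apply/esym; rewrite -subTset => v _.
  have [k _ Fk] : (\bigcup_k F k) (rV_uncons v).1 by rewrite -FT.
  have [l _ Gl] : (\bigcup_l G l) (rV_uncons v).2 by rewrite -GT.
  exists (maxn k l) => //; split => /=.
    by move: Fk; exact/subsetPset/ndF/leq_maxl.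
  by move: Gl; exact/subsetPset/ndG/leq_maxr.
move=> k; have [mF Fk] := Foo k; have [mG Gk] := Goo k; split.
  rewrite -[X in measurable X]setTI; apply: measurable_rV_uncons => //.
  exact: measurableX.
rewrite /lebesgue_rV_step /pushforward -comp_preimage.
rewrite (_ : rV_uncons \o rV_cons = id); last exact/funext/rV_consK.
by rewrite preimage_id product_measure1E// lte_mul_pinfty// ge0_fin_numE.
Qed.

HB.instance Definition _ := Measure_isSigmaFinite.Build _ _ _ lebesgue_rV_step
  step_sigma_finite.

End step.

(* Lebesgue measure on R^d, as the d-fold product of Lebesgue measure on R;
   on R^0 it is the unit mass at the only point. *)
Fixpoint lebesgue_rV (d : nat) : {sigma_finite_measure set 'rV[R]_d -> \bar R} :=
  if d is d'.+1 then lebesgue_rV_step (lebesgue_rV d') else dirac (0 : 'rV[R]_0).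

Lemma measurable_rV_box (d : nat) (A : 'I_d -> set (measurableTypeR R)) :
  (forall i, measurable (A i)) ->
  measurable [set x : 'rV[R]_d | forall i, A i (x ord0 i)].
Proof.
move=> mA; rewrite [X in measurable X](_ : _ = \bigcap_(i in [set: 'I_d])
    ((fun x : 'rV[R]_d => x ord0 i) @^-1` A i)).
  apply: fin_bigcap_measurable => //.
  by move=> i _; rewrite -[X in measurable X]setTI; apply: measurable_coord => //; exact: mA.
by apply/seteqP; split=> x /= h i; [move=> _|]; exact: h.
Qed.

Lemma lebesgue_rV_box (d : nat) (A : 'I_d -> set (measurableTypeR R)) :
  (forall i, measurable (A i)) ->
  lebesgue_rV d [set x : 'rV[R]_d | forall i, A i (x ord0 i)] =
  (\prod_(i < d) @lebesgue_measure R (A i))%E.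
Proof.
elim: d A => [|d IH] A mA.
  by rewrite big_ord0 /= diracE mem_set// => -[].
rewrite big_ord_recl /= /lebesgue_rV_step /pushforward.
rewrite [X in (_ \x _)%E X](_ : _ = A ord0 `*`
    [set x : 'rV[R]_d | forall i, A (lift ord0 i) (x ord0 i)]).
  rewrite product_measure1E//.
    by congr (_ * _)%E; exact: (IH (fun i => A (lift ord0 i))).
  exact: (measurable_rV_box (A := fun i => A (lift ord0 i))).
apply/seteqP; split=> -[x v] /=.
  move=> h; split=> [|i]; first by have := h ord0; rewrite rV_cons0.
  by have := h (lift ord0 i); rewrite rV_consS.
by move=> [h0 h] i; case: (unliftP ord0 i) => [j|] ->; rewrite ?rV_consS ?rV_cons0.
Qed.

End lebesgue_rV.

Section fourier.
Context {R : realType}.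

Definition cexpi (t : R) : R[i] := Complex (cos t) (sin t).

Definition cintegral d (T : measurableType d) (m : {measure set T -> \bar R})
    (F : T -> R[i]) : R[i] :=
  Complex (Rintegral m setT (fun x => complex.Re (F x)))
          (Rintegral m setT (fun x => complex.Im (F x))).

Definition inner (d : nat) (x y : 'rV[R]_d) : R :=
  \sum_(i < d) x ord0 i * y ord0 i.

Definition fourier (d : nat) (f : 'rV[R]_d -> R) (x : 'rV[R]_d) : R[i] :=
  cintegral (lebesgue_rV d)
    (fun y => Complex (f y) 0 * cexpi (- (2 * pi * inner x y))).

End fourier.

Section positivity_and_convexity.
Context {R : realType}.

(* As usual for real matrices, positive semi-definite includes symmetric. *)
Definition positive_semidefinite (k : nat) (A : 'M[R]_k) : Prop :=
  A^T = A /\ forall c : 'rV[R]_k, 0 <= (c *m A *m c^T) ord0 ord0.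

Definition positive_definite (d : nat) (h : 'rV[R]_d -> R) : Prop :=
  forall (k : nat) (x : 'I_k -> 'rV[R]_d),
    positive_semidefinite (\matrix_(i, j) h (x i - x j)).

(* Log-convexity and log-concavity are notions for functions with nonnegative
   values, so nonnegativity on C is part of the definition. *)
Definition log_convex (V : lmodType R) (C : set V) (f : V -> \bar R) : Prop :=
  (forall x, C x -> (0 <= f x)%E) /\
  forall (x y : V) (l : R), C x -> C y -> 0 < l < 1 ->
    (f (l *: x + (1 - l) *: y)%R <= (f x `^ l) * (f y `^ (1 - l)%R))%E.

Definition log_concave (V : lmodType R) (C : set V) (f : V -> \bar R) : Prop :=
  (forall x, C x -> (0 <= f x)%E) /\
  forall (x y : V) (l : R), C x -> C y -> 0 < l < 1 ->
    ((f x `^ l) * (f y `^ (1 - l)%R) <= f (l *: x + (1 - l) *: y)%R)%E.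

Definition decreasing_rearrangement (n : nat) (x : 'rV[R]_n) : seq R :=
  sort (fun a b : R => b <= a) [seq x ord0 i | i <- enum 'I_n].

Definition majorized (n : nat) (x y : 'rV[R]_n) : Prop :=
  let x' := decreasing_rearrangement x in
  let y' := decreasing_rearrangement y in
  (forall i : nat, (0 < i < n)%N ->
     \sum_(0 <= j < i) x'`_j <= \sum_(0 <= j < i) y'`_j) /\
  \sum_(0 <= j < n) x'`_j = \sum_(0 <= j < n) y'`_j.

Definition schur_concave (n : nat) (C : set 'rV[R]_n) (f : 'rV[R]_n -> \bar R)
  : Prop :=
  forall x y, C x -> C y -> majorized x y -> (f y <= f x)%E.

Definition nonneg_orthant (n : nat) : set 'rV[R]_n :=
  [set a | forall i, 0 <= a ord0 i].

End positivity_and_convexity.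
Arguments nonneg_orthant {R} n _.

Section random_vectors.
Context {R : realType} dT {T : measurableType dT} (P : probability T R).

(* Taking some of the B i to be the full space gives the product rule for the
   subfamilies. *)
Definition mutually_independent dV (V : measurableType dV) (n : nat)
    (X : 'I_n -> {RV P >-> V}) : Prop :=
  forall B : 'I_n -> set V, (forall i, measurable (B i)) ->
    P (\bigcap_(i in [set: 'I_n]) (X i @^-1` B i)) =
    (\prod_(i < n) P (X i @^-1` B i))%E.

Definition iid_with_law dV (V : measurableType dV) (n : nat)
    (X : 'I_n -> {RV P >-> V}) (mu : probability V R) : Prop :=
  mutually_independent X /\
  forall (i : 'I_n) (B : set V), measurable B -> distribution P (X i) B = mu B.

Definition associated_functional (d n : nat) (q : R)
    (X : 'I_n -> {RV P >-> 'rV[R]_d}) (h : 'rV[R]_d -> R) (a : 'rV[R]_n)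
  : \bar R :=
  'E_P[fun w => h (\sum_(i < n) (a ord0 i `^ q^-1) *: X i w)].

End random_vectors.

(* The function r |-> \hat f (r^(1/q) t); it is only used when \hat f takes
   nonnegative real values. *)
Definition fourier_ray {R : realType} (d : nat) (q : R) (f : 'rV[R]_d -> R)
    (t : 'rV[R]_d) (r : R^o) : R :=
  complex.Re (fourier f ((r `^ q^-1) *: t)).

(* Main.v *)
Require Import Defs.
From mathcomp Require Import all_boot all_order all_algebra.
From mathcomp Require Import all_classical all_reals all_analysis.
From mathcomp Require Import complex.
From mathcomp Require Import measurable_realfun zify ring lra.

Set Implicit Arguments.
Unset Strict Implicit.
Unset Printing Implicit Defensive.

Import Order.TTheory GRing.Theory Num.Theory.
Import numFieldNormedType.Exports.

Local Open Scope classical_set_scope.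
Local Open Scope ring_scope.

(** Write [Y_a = sum_i a_i^(1/q) X_i], so that [H(a) = E h(Y_a)], and
    [u_t(r)] for the value of the Fourier transform of [phi] at [r^(1/q) t].
    The Fourier transform of [phi] is real, so the X_i have vanishing sine
    transforms, and independence gives
      [E cos (2 pi <t, Y_a>) = prod_i u_t(a_i)]  and
      [E sin (2 pi <t, Y_a>) = 0]
    (lemmas [Re_fourier_density], [mean_sin_density] and
    [mean_cos_sum_independent]).

    Everything then rests on [mean_positive_definite_ge0]: if a finite real
    combination of laws of random vectors has vanishing sine transforms and a
    nonnegative cosine transform, then it gives a nonnegative integral to every
    continuous positive definite function [h]. This follows at once from
    Bochner's theorem, but it also has a direct proof with finite sums only.
    On a finite grid of mesh [l / N] in the box [[-l, l)^d], let
      [h_l(x) = sum_z K(x - z) w(z) h(z)],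
    where [w] is a product of tent functions, [K] a product of normalized
    Fejer kernels of period [2 l], and [z] runs over the grid.
    - The Fejer kernel is a combination of cosines with nonnegative
      coefficients, and [sum_z w(z) h(z) cos <s, z>] is, up to a positive
      factor, a double sum [sum_(u, v) h(u - v) cos <s, u - v>], hence is
      nonnegative; so the combination of laws gives a nonnegative integral to [h_l].
    - The orthogonality relations of the roots of unity compute exactly the
      total mass of [K] on the grid and its spread around [x], so that [h_l]
      tends to [h] pointwise when [l] and [N] go to infinity suitably;
      moreover [|h_l| <= h(0)], and dominated convergence concludes.

    Part 1. If the [u_t] are log-convex and [c = p a + (1 - p) b], then
    [prod_i u_t(c_i) <= A^p B^(1-p) <= p s1 A + (1 - p) s2 B], with [A] and [B]
    the products at [a] and [b], whenever [s1^p s2^(1-p) = 1]. The last bound is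
    linear in the laws, so it passes to [H]; optimizing over [s1], [s2] gives
    log-convexity ([weighted_young], [young_inf]).

    Part 2. If the [u_t] are log-concave, then [prod_i u_t(a_i)] is Schur concave
    in [a] by Karamata's inequality ([karamata_prod]); the difference of two
    such products is linear in the laws, so it passes to [H].

    The converses take for [h] the function [x |-> cos (2 pi <t, x>)], for which
    [H(a)] is [prod_i u_t(a_i)], at vectors with one or two nonzero entries.
    In Part 2 the vectors [(m, m, 0, ..)] and [(a, b, 0, ..)], with [m] the
    midpoint of [a] and [b], give midpoint log-concavity, and continuity does
    the rest ([midpoint_log_concave]). *)

(** * Expectations of bounded functions *)

(** Bounded measurable real functions: the class on which expectations are
    linear without side conditions. *)
Definition bdm (R : realType) d (T : measurableType d) (f : T -> R) :=
  measurable_fun setT f /\ exists M, forall x, `|f x| <= M.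

(** The expectation as a real number. *)
Definition mean (R : realType) d (T : measurableType d) (P : probability T R)
  (f : T -> R) : R := \int[P]_x f x.

Section bdm_theory.
Context {R : realType} d (T : measurableType d).
Implicit Types f g : T -> R.

Lemma bdm_cst (c : R) : bdm (fun _ : T => c).
Proof. by split; [exact: measurable_cst|exists `|c|]. Qed.

Lemma bdm_indic (A : set T) : measurable A -> bdm (\1_A : T -> R).
Proof.
move=> mA; split; first exact: measurable_indic.
by exists 1 => x; rewrite indicE; case: (_ \in _); rewrite ?normr1 ?normr0.
Qed.

Lemma bdmD f g : bdm f -> bdm g -> bdm (fun x => f x + g x).
Proof.
move=> [mf [M Mf]] [mg [N Ng]]; split; first exact: measurable_funD.
by exists (M + N) => x; apply: le_trans (ler_normD _ _) _; rewrite lerD.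
Qed.

Lemma bdmM f g : bdm f -> bdm g -> bdm (fun x => f x * g x).
Proof.
move=> [mf [M Mf]] [mg [N Ng]]; split; first exact: measurable_funM.
by exists (M * N) => x; rewrite normrM ler_pM.
Qed.

Lemma bdmZ c f : bdm f -> bdm (fun x => c * f x).
Proof. by move=> bf; apply: bdmM => //; exact: bdm_cst. Qed.

Lemma bdm_sum (I : Type) (r : seq I) (p : pred I) (F : I -> T -> R) :
  (forall i, bdm (F i)) -> bdm (fun x => \sum_(i <- r | p i) F i x).
Proof.
move=> bF; elim: r => [|i r IH].
  by under eq_fun do rewrite big_nil; exact: bdm_cst.
under eq_fun do rewrite big_cons.
by case: (p i) => //; exact: bdmD.
Qed.

Lemma bdm_prod (I : Type) (r : seq I) (p : pred I) (F : I -> T -> R) :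
  (forall i, bdm (F i)) -> bdm (fun x => \prod_(i <- r | p i) F i x).
Proof.
move=> bF; elim: r => [|i r IH].
  by under eq_fun do rewrite big_nil; exact: bdm_cst.
under eq_fun do rewrite big_cons.
by case: (p i) => //; exact: bdmM.
Qed.

Lemma bdm_comp d' (U : measurableType d') (X : U -> T) f :
  measurable_fun setT X -> bdm f -> bdm (fun w => f (X w)).
Proof.
move=> mX [mf [M Mf]]; split; last by exists M => w; exact: Mf.
exact: measurableT_comp.
Qed.

Lemma bdm_ge_set f (c : R) : bdm f -> measurable [set x | c <= f x].
Proof.
move=> [mf _]; rewrite -[X in measurable X]setTI.
rewrite [X in _ `&` X](_ : _ = f @^-1` `[c, +oo[%classic).
  exact: mf.
by apply/seteqP; split => x /=; rewrite in_itv/= andbT.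
Qed.

(** A linear functional that is bounded on functions with values in [0, 1] and
    vanishes on indicators vanishes. A function [f] with values in [0, 1] is
    half the indicator of [f >= 1/2] plus half of another such function, so the
    bound on [S f] can be halved indefinitely. *)
Lemma bdm_functional0 (S : (T -> R) -> R) (C : R) :
  (forall f g, bdm f -> bdm g -> S (fun x => f x + g x) = S f + S g) ->
  (forall c f, bdm f -> S (fun x => c * f x) = c * S f) ->
  (forall f, bdm f -> (forall x, 0 <= f x <= 1) -> `|S f| <= C) ->
  (forall A, measurable A -> S \1_A = 0) ->
  forall f, bdm f -> S f = 0.
Proof.
move=> SD SZ SC SA.
have step f : bdm f -> (forall x, 0 <= f x <= 1) ->
    exists g, [/\ bdm g, forall x, 0 <= g x <= 1 & S f = 2^-1 * S g].
  move=> bf f01; set A := [set x | 2^-1 <= f x].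
  have mA : measurable A by exact: bdm_ge_set.
  exists (fun x => 2 * f x + (-1) * \1_A x); split.
  - by apply: bdmD; apply: bdmZ => //; exact: bdm_indic.
  - move=> x; rewrite indicE; have := f01 x.
    have [/set_mem|] := boolP (x \in A).
      by rewrite /A /= mulr1n => ? /andP[? ?]; apply/andP; split; lra.
    move=> /negP nA /andP[? ?].
    have : f x < 2^-1 by rewrite ltNge; apply/negP => h; apply: nA; rewrite inE.
    by rewrite /= mulr0n => ?; apply/andP; split; lra.
  - have bA := bdm_indic mA.
    rewrite SD; [|exact: bdmZ|exact: bdmZ].
    by rewrite !SZ// SA// mulr0 addr0 mulrA mulVf ?mul1r.
have S01 f : bdm f -> (forall x, 0 <= f x <= 1) -> S f = 0.
  move=> bf f01.
  have bound k : `|S f| <= C / 2 ^+ k.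
    elim: k f bf f01 => [|k IH] f bf f01.
      by rewrite expr0 divr1; exact: SC.
    have [g [bg g01 ->]] := step _ bf f01.
    rewrite normrM gtr0_norm ?invr_gt0// exprS invfM mulrCA ler_pM2l ?invr_gt0//.
    exact: IH.
  apply/eqP; rewrite -normr_le0; apply/ler_addgt0Pl => e e0; rewrite addr0.
  have [C0|C0] := leP C 0.
    by apply: le_trans (bound 0%N) _; rewrite expr0 divr1; lra.
  have [k hk] : exists k : nat, C / e < 2 ^+ k.
    exists (Num.bound (C / e)).
    apply: lt_trans (archi_boundP _) _; first by rewrite divr_ge0// ltW.
    by rewrite -natrX ltr_nat ltn_expl.
  apply: le_trans (bound k) _; rewrite ler_pdivrMr ?exprn_gt0// mulrC.
  by rewrite -ler_pdivrMr// ltW.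
(* An affine change of variable brings a bounded function into [0, 1]. *)
move=> f bf; have [mf [M Mf]] := bf.
pose K := 2 * `|M| + 1.
have K0 : 0 < K by rewrite /K ltr_wpDl// mulr_ge0.
pose g x := K^-1 * (f x + `|M|).
have bg : bdm g by apply: bdmZ; apply: bdmD => //; exact: bdm_cst.
have g01 x : 0 <= g x <= 1.
  have := Mf x; have := ler_norm M => h1 h2.
  have : `|f x| <= `|M| by lra.
  rewrite ler_norml => /andP[h3 h4]; apply/andP; split.
    by rewrite mulr_ge0// ?invr_ge0 ?(ltW K0)//; lra.
  by rewrite /g mulrC ler_pdivrMr// /K; lra.
have -> : f = (fun x => K * g x + (- `|M|) * 1).
  by apply/funext => x; rewrite /g mulrA divff ?gt_eqF// mul1r mulr1 addrK.
have b1 : bdm (fun _ : T => 1 : R) by exact: bdm_cst.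
rewrite (SD (fun x => K * g x) (fun=> - `|M| * 1)); [|exact: bdmZ|exact: (bdmZ _ b1)].
rewrite (SZ K g)// (SZ (- `|M|) (fun=> 1))//.
rewrite S01// (_ : (fun=> 1) = \1_setT); last by apply/funext => x; rewrite indicT.
by rewrite SA// !mulr0 addr0.
Qed.

Variable P : probability T R.

Lemma bdm_integrable f : bdm f -> P.-integrable setT (EFin \o f).
Proof.
move=> [mf [M Mf]]; apply: measurable_bounded_integrable => //.
  by rewrite (le_lt_trans (probability_le1 P measurableT))// ltry.
exists M; split; first exact: num_real.
by move=> x Mx y _; exact: le_trans (Mf y) (ltW Mx).
Qed.

Lemma expectation_mean f : bdm f -> 'E_P[f]%E = (mean P f)%:E.
Proof.
move=> bf; rewrite unlock /mean /Rintegral fineK//.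
exact/integrable_fin_num/bdm_integrable.
Qed.

Lemma meanD f g : bdm f -> bdm g ->
  mean P (fun x => f x + g x) = mean P f + mean P g.
Proof. by move=> bf bg; rewrite /mean RintegralD//; exact: bdm_integrable. Qed.

Lemma meanZ c f : bdm f -> mean P (fun x => c * f x) = c * mean P f.
Proof. by move=> bf; rewrite /mean RintegralZl//; exact: bdm_integrable. Qed.

Lemma meanB f g : bdm f -> bdm g ->
  mean P (fun x => f x - g x) = mean P f - mean P g.
Proof. by move=> bf bg; rewrite /mean RintegralB//; exact: bdm_integrable. Qed.

Lemma mean_cst c : mean P (fun _ => c) = c.
Proof.
rewrite /mean Rintegral_cst// [X in fine X](_ : _ = 1%E) ?mulr1//.
exact: probability_setT.
Qed.

Lemma mean_indic (A : set T) : measurable A -> mean P \1_A = fine (P A).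
Proof. by move=> mA; rewrite /mean /Rintegral integral_indic// setIT. Qed.

Lemma mean_sum (I : Type) (r : seq I) (F : I -> T -> R) :
  (forall i, bdm (F i)) ->
  mean P (fun x => \sum_(i <- r) F i x) = \sum_(i <- r) mean P (F i).
Proof.
move=> bF; elim: r => [|i r IH].
  by under eq_fun do rewrite big_nil; rewrite mean_cst big_nil.
under eq_fun do rewrite big_cons.
by rewrite meanD ?IH ?big_cons//; exact: bdm_sum.
Qed.

Lemma le_mean f g : bdm f -> bdm g -> (forall x, f x <= g x) ->
  mean P f <= mean P g.
Proof. by move=> bf bg fg; apply: le_Rintegral => //; exact: bdm_integrable. Qed.

Lemma norm_mean_le f M : bdm f -> (forall x, `|f x| <= M) -> `|mean P f| <= M.
Proof.
move=> bf fM; rewrite ler_norml -[M in X in _ && X]mean_cst -[- M]mean_cst.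
by apply/andP; split; apply: le_mean => //;
  (try exact: bdm_cst) => x; have := fM x; rewrite ler_norml => /andP[].
Qed.

End bdm_theory.

Section law.
Context {R : realType} dT (T : measurableType dT) (P : probability T R).
Context dV (V : measurableType dV) (mu : probability V R).

Lemma mean_law (X : {RV P >-> V}) (f : V -> R) :
  (forall B, measurable B -> distribution P X B = mu B) -> bdm f ->
  mean P (fun w => f (X w)) = mean mu f.
Proof.
move=> Xmu bf; apply/eqP; rewrite -subr_eq0; apply/eqP.
have mX : measurable_fun setT X by exact: measurable_funPT.
have cX g : bdm g -> bdm (fun w => g (X w)) by exact: bdm_comp.
apply: (bdm_functional0 (S := fun f => mean P (fun w => f (X w)) - mean mu f)
  (C := 2)) => //.
- by move=> g k bg bk; rewrite !meanD//; first ring; exact: cX.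
- by move=> c g bg; rewrite !meanZ//; first ring; exact: cX.
- move=> g bg g01; apply: le_trans (ler_normB _ _) _.
  have g1 x : `|g x| <= 1 by have /andP[? ?] := g01 x; rewrite ger0_norm.
  by rewrite (_ : 2 = 1 + 1)//; apply: lerD; apply: norm_mean_le => //; exact: cX.
- move=> A mA; have mXA : measurable (X @^-1` A).
    by rewrite -[X in measurable X]setTI; exact: mX.
  rewrite (_ : (fun w => \1_A (X w)) = \1_(X @^-1` A) :> (T -> R)); last exact/funext.
  rewrite !mean_indic// [X in _ - fine X](_ : _ = P (X @^-1` A)) ?subrr//.
  by symmetry; exact: Xmu.
Qed.

End law.

(** * Laws with a density *)

Section density.
Context {R : realType} dV (V : measurableType dV).
Variables (m : {measure set V -> \bar R}) (mu : probability V R) (phi : V -> R).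
Hypothesis mphi : measurable_fun setT phi.
Hypothesis hmu : forall A, measurable A -> mu A = (\int[m]_(x in A) (phi x)%:E)%E.

(** No sign is assumed on [phi], but it is nonnegative almost everywhere, since
    its integral over [phi < 0] is the measure of that set, hence is not negative. *)
Lemma density_integrable : m.-integrable setT (EFin \o phi).
Proof.
apply/integrableP; split; first exact/measurable_EFinP.
set A := [set x | 0 <= phi x].
have mA : measurable A.
  rewrite -[X in measurable X]setTI (_ : A = phi @^-1` `[0, +oo[%classic).
    exact: mphi.
  by apply/seteqP; split => x /=; rewrite /A /= in_itv/= andbT.
rewrite -(setUv A) ge0_integral_setU//=; last 3 first.
- exact: measurableC.
- by rewrite setUv; apply/measurable_EFinP/measurableT_comp.
- exact/disj_setPCl.
apply: lte_add_pinfty.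
- rewrite (_ : (\int[m]_(x in A) _)%E = mu A).
    by rewrite (le_lt_trans (probability_le1 mu mA))// ltry.
  by rewrite hmu//; apply: eq_integral => x /set_mem Ax /=; rewrite ger0_norm.
- have mA' : measurable (~` A) by exact: measurableC.
  rewrite (_ : (\int[m]_(x in ~` A) _)%E = (- mu (~` A))%E).
    by rewrite (le_lt_trans _ (ltry 0))// leeNl oppe0.
  have neg x : (~` A) x -> phi x < 0 by move=> /negP; rewrite -ltNge.
  have -> : mu (~` A) = (- \int[m]_(x in ~` A) (- (phi x)%:E))%E.
    rewrite -integral_ge0N => [|x /neg]; last by rewrite -EFinN lee_fin oppr_ge0 => /ltW.
    by rewrite hmu//; apply: eq_integral => x _; rewrite oppeK.
  rewrite oppeK; apply: eq_integral => x /set_mem /neg px /=.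
  by rewrite ltr0_norm.
Qed.

Lemma mean_density (f : V -> R) : bdm f ->
  \int[m]_x (phi x * f x) = mean mu f.
Proof.
have iphi := density_integrable.
have ip g : bdm g -> m.-integrable setT (EFin \o (fun x => phi x * g x)).
  move=> [mg [M Mg]]; rewrite (_ : _ \o _ = (EFin \o phi) \* (EFin \o g))%E//.
  apply: integrableMl => //.
  exists M; split; first exact: num_real.
  by move=> x Mx y _; exact: le_trans (Mg y) (ltW Mx).
move=> bf; apply/eqP; rewrite -subr_eq0; apply/eqP.
apply: (bdm_functional0 (S := fun f => \int[m]_x (phi x * f x) - mean mu f)
  (C := \int[m]_x `|phi x| + 1)) => //.
- move=> g k bg bk; rewrite meanD//.
  under eq_Rintegral do rewrite mulrDr.
  by rewrite RintegralD//; [ring|exact: ip|exact: ip].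
- move=> c g bg; rewrite meanZ//.
  under eq_Rintegral do rewrite mulrCA.
  by rewrite RintegralZl//; [ring|exact: ip].
- move=> g bg g01.
  have g1 x : `|g x| <= 1 by have /andP[? ?] := g01 x; rewrite ger0_norm.
  apply: le_trans (ler_normB _ _) _; apply: lerD; last exact: norm_mean_le.
  apply: le_trans (le_normr_Rintegral _ (ip _ bg)) _ => //.
  have iabs h : m.-integrable setT (EFin \o h) ->
      m.-integrable setT (EFin \o (fun x => `|h x|)) by exact: integrable_norm.
  apply: le_Rintegral => //; [exact/iabs/ip|exact: iabs|].
  by move=> x _; rewrite normrM ler_piMr.
- move=> A mA; rewrite mean_indic// hmu// /Rintegral.
  rewrite [X in fine X - _](_ : _ = \int[m]_(x in A) (phi x)%:E)%E ?subrr//.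
  rewrite [RHS]integral_mkcond; apply: eq_integral => x _ /=.
  by rewrite patchE indicE; case: (_ \in _); rewrite ?mulr1 ?mulr0.
Qed.

End density.

(** * Independent random vectors *)

Section independence.
Context {R : realType} dT (T : measurableType dT) (P : probability T R).
Context dV (V : measurableType dV) (n : nat) (X : 'I_n -> {RV P >-> V}).

Let mX i : measurable_fun setT (X i). Proof. exact: measurable_funPT. Qed.

(* The family [f] with its member of index [i] replaced by [g]. *)
Let with_factor (f : 'I_n -> V -> R) i g j := if j == i then g else f j.

Let bdm_with_factor f i g : (forall j, bdm (f j)) -> bdm g ->
  forall j, bdm (with_factor f i g j).
Proof. by move=> bf bg j; rewrite /with_factor; case: eqP. Qed.

Let prod_with_factor (F : (V -> R) -> 'I_n -> R) f i g :
  \prod_j F (with_factor f i g j) j = F g i * \prod_(j | j != i) F (f j) j.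
Proof.
rewrite (bigD1 i)//= /with_factor eqxx; congr (_ * _).
by apply: eq_bigr => j /negbTE ->.
Qed.

Hypothesis indX : mutually_independent X.

(** The product rule for sets extends to bounded functions one index at a time:
    outside of the list [r] the functions are still indicators. *)
Lemma mean_prod_independent (f : 'I_n -> V -> R) : (forall i, bdm (f i)) ->
  mean P (fun w => \prod_i f i (X i w)) =
  \prod_i mean P (fun w => f i (X i w)).
Proof.
suff H (r : seq 'I_n) : forall f : 'I_n -> V -> R, (forall i, bdm (f i)) ->
    (forall i, i \notin r -> exists2 A, measurable A & f i = \1_A) ->
    mean P (fun w => \prod_i f i (X i w)) =
    \prod_i mean P (fun w => f i (X i w)).
  by move=> bf; apply: (H (enum 'I_n)) => // i; rewrite mem_enum.
elim: r => [|i r IH] {}f bf fA.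
  have {fA} /choice[A fA] i : exists A, measurable A /\ f i = \1_A.
    by have [//|A] := fA i; exists A.
  have mA i : measurable (X i @^-1` A i).
    by rewrite -[X in measurable X]setTI; apply: mX => //; exact: (fA i).1.
  have -> : (fun w => \prod_i f i (X i w)) =
      \1_(\bigcap_(i in [set: 'I_n]) (X i @^-1` A i)) :> (T -> R).
    apply/funext => w; rewrite indicE.
    have [/set_mem h|/negP h] := boolP (w \in _).
      by rewrite big1// => i _; rewrite (fA i).2 indicE mem_set//; exact: h.
    have [i hi] : exists i, ~ A i (X i w).
      apply: contrapT => /forallNP h'; apply: h; rewrite inE => i _.
      exact: contrapT (h' i).
    by rewrite (bigD1 i)//= (fA i).2 indicE memNset// mul0r.
  rewrite mean_indic; last by apply: fin_bigcap_measurable.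
  apply: EFin_inj; rewrite fineK; last by apply: fin_num_measure; apply: fin_bigcap_measurable.
  rewrite indX => [|i]; last exact: (fA i).1.
  rewrite -prodEFin; apply: eq_bigr => i _.
  rewrite (_ : (fun w => f i (X i w)) = \1_(X i @^-1` A i)); last first.
    by apply/funext => w; rewrite (fA i).2.
  by rewrite mean_indic// fineK// fin_num_measure.
pose F w := \prod_(j | j != i) f j (X j w).
pose c := \prod_(j | j != i) mean P (fun w => f j (X j w)).
have bF : bdm F by apply: bdm_prod => j; exact: bdm_comp.
have bX (g : V -> R) : bdm g -> bdm (fun w => g (X i w)) by exact: bdm_comp.
have bXF g : bdm g -> bdm (fun w => g (X i w) * F w).
  by move=> bg; apply: bdmM => //; exact: bX.
rewrite (bigD1 i)//= -/c.
rewrite (_ : (fun w => _) = (fun w => f i (X i w) * F w)); last first.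
  by apply/funext => w; rewrite (bigD1 i).
have [_ [M FM]] := bF.
apply/eqP; rewrite -subr_eq0; apply/eqP.
apply: (bdm_functional0 (C := M + `|c|)
  (S := fun g => mean P (fun w => g (X i w) * F w)
                 - mean P (fun w => g (X i w)) * c)) => //.
- move=> g k bg bk; rewrite (meanD P (bX _ bg) (bX _ bk)).
  under eq_fun do rewrite mulrDl.
  by rewrite (meanD P (bXF _ bg) (bXF _ bk)); ring.
- move=> a g bg; rewrite (meanZ P _ (bX _ bg)).
  under eq_fun do rewrite -mulrA.
  by rewrite (meanZ P _ (bXF _ bg)); ring.
- move=> g bg g01.
  have g1 x : `|g x| <= 1 by have /andP[? ?] := g01 x; rewrite ger0_norm.
  apply: le_trans (ler_normB _ _) _; apply: lerD.
    apply: norm_mean_le => [|w]; first exact: bXF.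
    by rewrite normrM -[M]mul1r ler_pM.
  rewrite normrM ler_piMl//; apply: norm_mean_le => [|w]; first exact: bX.
  exact: g1.
- move=> A mA; apply/eqP; rewrite subr_eq0; apply/eqP.
  have := IH (with_factor f i \1_A).
  rewrite (prod_with_factor (fun g j => mean P (fun w => g (X j w)))).
  rewrite -/c => <-.
  + congr mean; apply/funext => w.
    by rewrite (prod_with_factor (fun g j => g (X j w))).
  + by apply: bdm_with_factor => //; exact: bdm_indic.
  + move=> j jr; rewrite /with_factor; case: eqP => [_|/eqP ji]; first by exists A.
    by apply: fA; rewrite inE negb_or ji.
Qed.

(** The characteristic function of a sum of independent variables, when those
    of the terms are real. *)
Lemma mean_cos_sum_independent (th : 'I_n -> V -> R) :
  (forall i, measurable_fun setT (th i)) ->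
  (forall i, mean P (fun w => sin (th i (X i w))) = 0) ->
  mean P (fun w => cos (\sum_i th i (X i w))) =
    \prod_i mean P (fun w => cos (th i (X i w))) /\
  mean P (fun w => sin (\sum_i th i (X i w))) = 0.
Proof.
move=> mth Esin0.
have bcos i : bdm (fun v => cos (th i v)).
  split; last by exists 1 => x; exact: cos_max.
  by apply: measurableT_comp => //; apply: continuous_measurable_fun; exact: continuous_cos.
have bsin i : bdm (fun v => sin (th i v)).
  split; last by exists 1 => x; exact: sin_max.
  by apply: measurableT_comp => //; apply: continuous_measurable_fun; exact: continuous_sin.
have bgX (g : 'I_n -> V -> R) : (forall i, bdm (g i)) -> bdm (fun w => \prod_i g i (X i w)).
  by move=> bg; apply: bdm_prod => i; exact: bdm_comp.
have mS (r : seq 'I_n) : measurable_fun setT (fun w => \sum_(i <- r) th i (X i w)).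
  by apply: measurable_sum => i; exact: measurableT_comp.
have bcS r : bdm (fun w => cos (\sum_(i <- r) th i (X i w))).
  split; last by exists 1 => x; exact: cos_max.
  by apply: measurableT_comp => //; apply: continuous_measurable_fun; exact: continuous_cos.
have bsS r : bdm (fun w => sin (\sum_(i <- r) th i (X i w))).
  split; last by exists 1 => x; exact: sin_max.
  by apply: measurableT_comp => //; apply: continuous_measurable_fun; exact: continuous_sin.
(* The addition formulas split the angles off one at a time into the product
   on the right, whose factors of index in [r] are kept equal to 1. *)
suff H (r : seq 'I_n) : uniq r -> forall g : 'I_n -> V -> R,
    (forall i, bdm (g i)) -> (forall i, i \in r -> g i = fun=> 1) ->
    mean P (fun w => cos (\sum_(i <- r) th i (X i w)) * \prod_i g i (X i w)) =
      (\prod_(i <- r) mean P (fun w => cos (th i (X i w)))) *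
      \prod_i mean P (fun w => g i (X i w)) /\
    mean P (fun w => sin (\sum_(i <- r) th i (X i w)) * \prod_i g i (X i w)) = 0.
  have [] := H (index_enum 'I_n) (index_enum_uniq _) (fun _ _ => 1).
  - by move=> i; exact: bdm_cst.
  - by [].
  - under eq_fun do rewrite [\prod_i _]big1// mulr1.
    rewrite [X in _ * X]big1 ?mulr1 => [->|i _]; last by rewrite mean_cst.
    under eq_fun do rewrite [\prod_i _]big1// mulr1.
    by move=> ->.
elim: r => [_|i r IH /=/andP[ir ur]] g bg g1.
  rewrite !big_nil mul1r; split.
    under eq_fun do rewrite big_nil cos0 mul1r.
    by rewrite mean_prod_independent.
  under eq_fun do rewrite big_nil sin0 mul0r.
  by rewrite mean_cst.
have gi : g i = fun=> 1 by apply: g1; rewrite mem_head.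
have prodg k w : \prod_j with_factor g i k j (X j w) = k (X i w) * \prod_j g j (X j w).
  rewrite (prod_with_factor (fun k j => k (X j w))) [in RHS](bigD1 i)//=.
  by rewrite gi mul1r.
have prodm k : \prod_j mean P (fun w => with_factor g i k j (X j w)) =
    mean P (fun w => k (X i w)) * \prod_j mean P (fun w => g j (X j w)).
  rewrite (prod_with_factor (fun k j => mean P (fun w => k (X j w)))).
  by rewrite [in RHS](bigD1 i)//= gi mean_cst mul1r.
have gr1 k j : j \in r -> with_factor g i k j = fun=> 1.
  move=> jr; rewrite /with_factor; case: eqP => [ji|_].
    by move: ir; rewrite -ji jr.
  by apply: g1; rewrite inE jr orbT.
have bc := bdm_with_factor i bg (bcos i).
have bs := bdm_with_factor i bg (bsin i).
have [cc sc] := IH ur _ bc (gr1 _).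
have [cs ss] := IH ur _ bs (gr1 _).
split.
- transitivity (mean P (fun w =>
    cos (\sum_(i <- r) th i (X i w)) *
      \prod_j with_factor g i (fun v => cos (th i v)) j (X j w)
    - sin (\sum_(i <- r) th i (X i w)) *
      \prod_j with_factor g i (fun v => sin (th i v)) j (X j w))).
    congr mean; apply/funext => w; rewrite !prodg big_cons cosD; ring.
  rewrite meanB; [|exact: bdmM (bcS r) (bgX _ bc)|exact: bdmM (bsS r) (bgX _ bs)].
  by rewrite ss cc subr0 prodm big_cons; ring.
- transitivity (mean P (fun w =>
    sin (\sum_(i <- r) th i (X i w)) *
      \prod_j with_factor g i (fun v => cos (th i v)) j (X j w)
    + cos (\sum_(i <- r) th i (X i w)) *
      \prod_j with_factor g i (fun v => sin (th i v)) j (X j w))).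
    congr mean; apply/funext => w; rewrite !prodg big_cons sinD; ring.
  rewrite meanD; [|exact: bdmM (bsS r) (bgX _ bc)|exact: bdmM (bcS r) (bgX _ bs)].
  by rewrite sc cs prodm Esin0 add0r mul0r mulr0.
Qed.

End independence.

(** * Positive definite functions *)

Section inner_product.
Context {R : realType} {d : nat}.
Implicit Types s x y : 'rV[R]_d.

Lemma innerC x y : inner x y = inner y x.
Proof. by apply: eq_bigr => i _; rewrite mulrC. Qed.

Lemma innerDr s x y : inner s (x + y) = inner s x + inner s y.
Proof. by rewrite -big_split; apply: eq_bigr => i _; rewrite mxE mulrDr. Qed.

Lemma innerZr s c x : inner s (c *: x) = c * inner s x.
Proof. by rewrite mulr_sumr; apply: eq_bigr => i _; rewrite mxE mulrCA. Qed.

Lemma innerBr s x y : inner s (x - y) = inner s x - inner s y.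
Proof. by rewrite innerDr -scaleN1r innerZr mulN1r. Qed.

Lemma innerDl s x y : inner (x + y) s = inner x s + inner y s.
Proof. by rewrite innerC innerDr !(innerC s). Qed.

Lemma innerBl s x y : inner (x - y) s = inner x s - inner y s.
Proof. by rewrite innerC innerBr !(innerC s). Qed.

Lemma innerZl s c x : inner (c *: x) s = c * inner x s.
Proof. by rewrite innerC innerZr innerC. Qed.

Lemma inner0l x : inner 0 x = 0.
Proof. by rewrite /inner big1// => i _; rewrite mxE mul0r. Qed.

Lemma inner_sumr s n (x : 'I_n -> 'rV[R]_d) :
  inner s (\sum_i x i) = \sum_i inner s (x i).
Proof.
elim/big_ind2: _ => [|_ u _ v <- <-|//]; last by rewrite innerDr.
by rewrite innerC inner0l.
Qed.

Lemma continuous_inner s : continuous (inner s).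
Proof.
have addc : continuous (fun z : R * R => z.1 + z.2) by exact: add_continuous.
apply: (continuous_big addc) => i _.
move=> x; apply: continuousM; first exact: cst_continuous.
exact: (@coord_continuous R 1 d ord0 i x).
Qed.

End inner_product.

Section positive_definite_functions.
Context {R : realType} {d : nat}.
Implicit Types h : 'rV[R]_d -> R.

Lemma positive_definite_sum h (I : finType) (x : I -> 'rV[R]_d) (c : I -> R) :
  positive_definite h -> 0 <= \sum_i \sum_j c i * c j * h (x i - x j).
Proof.
move=> /(_ #|I| (x \o enum_val))[_ /(_ (\row_i c (enum_val i)))].
rewrite mxE (reindex _ (onW_bij _ (@enum_val_bij I))).
under [X in _ -> 0 <= X]eq_bigr do rewrite (reindex _ (onW_bij _ (@enum_val_bij I))).
rewrite exchange_big /=; congr (0 <= _); apply: eq_bigr => i _.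
rewrite mxE mulr_suml; apply: eq_bigr => j _.
by rewrite !mxE mulrAC.
Qed.

Lemma positive_definite_even h x : positive_definite h -> h (- x) = h x.
Proof.
move=> /(_ 2%N (fun i => if i == ord0 then x else 0))[/matrixP/(_ ord0 ord_max)+ _].
by rewrite !mxE/= sub0r subr0.
Qed.

Lemma positive_definite_le0 h x : positive_definite h -> `|h x| <= h 0.
Proof.
move=> hpd.
have := positive_definite_sum (fun b : bool => if b then x else 0) (fun=> 1) hpd.
have := positive_definite_sum (fun b : bool => if b then x else 0)
  (fun b : bool => if b then 1 else -1) hpd.
rewrite !big_bool/= !subrr subr0 sub0r positive_definite_even// => h1 h2.
by rewrite ler_norml; apply/andP; split; lra.
Qed.

Lemma positive_definite_ge0 h : positive_definite h -> 0 <= h 0.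
Proof. by move=> /(positive_definite_le0 0); apply: le_trans; exact: normr_ge0. Qed.

Lemma positive_definite_cos_sum h (I : finType) (x : I -> 'rV[R]_d) s :
  positive_definite h ->
  0 <= \sum_i \sum_j h (x i - x j) * cos (inner s (x i - x j)).
Proof.
move=> hpd; pose S c := \sum_i \sum_j c (inner s (x i)) * c (inner s (x j)) * h (x i - x j).
rewrite [leRHS](_ : _ = S cos + S sin).
  by apply: addr_ge0; apply: positive_definite_sum.
rewrite -big_split; apply: eq_bigr => i _; rewrite -big_split; apply: eq_bigr => j _.
by rewrite innerBr cosB /=; ring.
Qed.

Lemma positive_definite_cos s : positive_definite (fun x : 'rV[R]_d => cos (inner s x)).
Proof.
move=> k x; split.
  by apply/matrixP => i j; rewrite !mxE -[LHS]cosN !innerBr opprB.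
move=> c.
rewrite [leRHS](_ : _ = (\sum_i c ord0 i * cos (inner s (x i))) ^+ 2 +
                        (\sum_i c ord0 i * sin (inner s (x i))) ^+ 2).
  by rewrite addr_ge0// sqr_ge0.
rewrite !expr2 !mulr_suml -big_split mxE /=; apply: eq_bigr => j _.
rewrite !mulr_sumr -big_split mxE mulr_suml /=; apply: eq_bigr => i _.
by rewrite !mxE innerBr cosB; ring.
Qed.

Lemma continuous_cos_inner s : continuous (fun x : 'rV[R]_d => cos (inner s x)).
Proof.
by move=> x; apply: continuous_comp; [exact: continuous_inner|exact: continuous_cos].
Qed.

End positive_definite_functions.

(** * Nonnegative combinations of cosines *)

Section cosine_cone.
Context {R : realType} {d : nat}.

(** Finite nonnegative combinations of the functions [x |-> cos <s, x>]: the
    cosine transforms of finitely supported measures. *)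
Inductive cosine_cone : ('rV[R]_d -> R) -> Prop :=
| cosine_cone_cos s : cosine_cone (fun x => cos (inner s x))
| cosine_cone0 : cosine_cone (fun=> 0)
| cosine_coneD f g : cosine_cone f -> cosine_cone g ->
    cosine_cone (fun x => f x + g x)
| cosine_coneZ c f : 0 <= c -> cosine_cone f -> cosine_cone (fun x => c * f x).

Lemma cosine_coneM f g : cosine_cone f -> cosine_cone g ->
  cosine_cone (fun x => f x * g x).
Proof.
move=> cf cg; elim: cf => {f} [s||f1 f2 _ c1 _ c2|c f c0 _ cf].
- elim: cg => {g} [t||f1 f2 _ c1 _ c2|c f c0 _ cf].
  + rewrite [X in cosine_cone X](_ : _ =
      fun x => 2^-1 * (cos (inner (s + t) x) + cos (inner (s - t) x))).
      apply: cosine_coneZ; first by rewrite invr_ge0.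
      by apply: cosine_coneD; exact: cosine_cone_cos.
    by apply/funext => x; rewrite innerDl innerBl cosD cosB; field.
  + by under eq_fun do rewrite mulr0; exact: cosine_cone0.
  + by under eq_fun do rewrite mulrDr; exact: cosine_coneD.
  + by under eq_fun do rewrite mulrCA; exact: cosine_coneZ.
- by under eq_fun do rewrite mul0r; exact: cosine_cone0.
- by under eq_fun do rewrite mulrDl; exact: cosine_coneD.
- by under eq_fun do rewrite -mulrA; exact: cosine_coneZ.
Qed.

Lemma cosine_cone1 : cosine_cone (fun=> 1).
Proof.
rewrite [X in cosine_cone X](_ : _ = fun x => cos (inner 0 x)).
  exact: cosine_cone_cos.
by apply/funext => x; rewrite inner0l cos0.
Qed.

Lemma cosine_cone_sum (I : Type) (r : seq I) (F : I -> 'rV[R]_d -> R) :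
  (forall i, cosine_cone (F i)) -> cosine_cone (fun x => \sum_(i <- r) F i x).
Proof.
move=> cF; elim: r => [|i r IH].
  by under eq_fun do rewrite big_nil; exact: cosine_cone0.
by under eq_fun do rewrite big_cons; exact: cosine_coneD.
Qed.

Lemma cosine_cone_prod (I : Type) (r : seq I) (F : I -> 'rV[R]_d -> R) :
  (forall i, cosine_cone (F i)) -> cosine_cone (fun x => \prod_(i <- r) F i x).
Proof.
move=> cF; elim: r => [|i r IH].
  by under eq_fun do rewrite big_nil; exact: cosine_cone1.
by under eq_fun do rewrite big_cons; exact: cosine_coneM.
Qed.

Lemma cosine_cone_coord (c : R) (i : 'I_d) : cosine_cone (fun x => cos (c * x ord0 i)).
Proof.
rewrite [X in cosine_cone X](_ : _ =
    fun x => cos (inner (\row_j (c * (j == i)%:R)) x)).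
  exact: cosine_cone_cos.
apply/funext => x; congr cos; rewrite /inner (bigD1 i)//= mxE eqxx mulr1.
by rewrite big1 ?addr0// => j /negbTE ji; rewrite mxE ji mulr0 mul0r.
Qed.

End cosine_cone.

(** * The Fejer kernel on equidistant nodes *)

Section fejer.
Context {R : realType}.
Implicit Types x y : R.

(** The Fejer kernel of order [N], of period [2 pi] and mean value 1. *)
Definition fejer (N : nat) x : R :=
  N%:R^-1 * \sum_(a < N) \sum_(b < N) cos ((a%:R - b%:R) * x).

Lemma fejer_ge0 N x : 0 <= fejer N x.
Proof.
rewrite /fejer mulr_ge0 ?invr_ge0//.
rewrite [leRHS](_ : _ = (\sum_(a < N) cos (a%:R * x)) ^+ 2 +
                        (\sum_(a < N) sin (a%:R * x)) ^+ 2).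
  by rewrite addr_ge0// sqr_ge0.
rewrite !expr2 !mulr_suml -big_split; apply: eq_bigr => a _ /=.
rewrite !mulr_sumr -big_split; apply: eq_bigr => b _ /=.
by rewrite mulrBl cosB.
Qed.

Lemma cosine_cone_fejer d N (c : R) (i : 'I_d) :
  cosine_cone (fun x : 'rV[R]_d => fejer N (c * x ord0 i)).
Proof.
apply: cosine_coneZ; first by rewrite invr_ge0.
apply: cosine_cone_sum => a; apply: cosine_cone_sum => b.
by under eq_fun do rewrite mulrA; exact: cosine_cone_coord.
Qed.

(** The orthogonality relation of the K-th roots of unity, in real form. *)
Lemma cos_sum_roots (K m : nat) x : (0 < m < K)%N ->
  \sum_(k < K) cos (x + k%:R * (m%:R * (pi *+ 2 / K%:R))) = 0.
Proof.
move=> /andP[m0 mK]; set b := m%:R * _.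
have K0 : (0 : R) < K%:R by rewrite ltr0n (leq_trans _ mK).
have b2 : b / 2 = m%:R / K%:R * pi by rewrite /b mulr2n; field; rewrite gt_eqF.
have sb : 0 < sin (b / 2).
  apply: sin_gt0_pi; rewrite b2 mulr_gt0 ?pi_gt0//=; last first.
    by rewrite divr_gt0// ltr0n.
  by rewrite gtr_pMl ?pi_gt0// ltr_pdivrMr// mul1r ltr_nat.
(* Multiplied by [2 sin (b / 2)] the sum telescopes. *)
apply: (mulfI (_ : 2 * sin (b / 2) != 0)); first by rewrite gt_eqF// mulr_gt0.
rewrite mulr0 mulr_sumr.
pose G k := sin (x + (k%:R - 2^-1) * b).
rewrite (eq_bigr (fun k : 'I_K => G k.+1 - G k)) => [|k _].
  rewrite -(big_mkord xpredT (fun k => G k.+1 - G k)) telescope_sumr// /G.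
  rewrite (_ : x + (K%:R - 2^-1) * b = x + (0 - 2^-1) * b + pi *+ 2 *+ m).
    by rewrite (periodicn (@sinD2pi R)) subrr.
  rewrite /b -[pi *+ 2 *+ m]mulr_natl; field; by rewrite gt_eqF.
have hS : x + (k.+1%:R - 2^-1) * b = (x + k%:R * b) + b / 2 by rewrite -natr1; field.
have hk : x + (k%:R - 2^-1) * b = (x + k%:R * b) - b / 2 by field.
rewrite /G hS hk.
by rewrite sinD sinB; ring.
Qed.

Variable N : nat.
Hypothesis N0 : (0 < N)%N.
Variable x : R.

(* There are [2 N] nodes, so that the frequencies met below, at most [N] in
   absolute value, are resolved. *)
Let node (k : nat) : R := x - k%:R * (pi / N%:R).

Let N0' : (0 : R) < N%:R. Proof. by rewrite ltr0n. Qed.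

Let N2E : N.*2%:R = 2 * N%:R :> R. Proof. by rewrite -mul2n natrM. Qed.

Lemma cos_sum_nodes (p r : nat) : (p < r + N.*2)%N -> (r < p + N.*2)%N ->
  \sum_(k < N.*2) cos ((p%:R - r%:R) * node k) = (p == r)%:R * N.*2%:R.
Proof.
have gen (m : nat) : (0 < m < N.*2)%N -> \sum_(k < N.*2) cos (m%:R * node k) = 0.
  move=> mN; rewrite -[RHS](cos_sum_roots (- (m%:R * x)) mN).
  apply: eq_bigr => k _; rewrite -cosN; congr cos.
  rewrite /node N2E mulr2n; field; by rewrite gt_eqF.
move=> h1 h2; case: (ltngtP p r) => pr /=.
- rewrite mul0r -[RHS](gen (r - p)%N).
    apply: eq_bigr => k _; rewrite natrB; last exact: ltnW.
    by rewrite -[LHS]cosN -mulNr opprB.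
  by rewrite subn_gt0 pr/= ltn_subLR// ltnW.
- rewrite mul0r -[RHS](gen (p - r)%N).
    by apply: eq_bigr => k _; rewrite natrB; last exact: ltnW.
  by rewrite subn_gt0 pr/= ltn_subLR// ltnW.
- rewrite pr mul1r (eq_bigr (fun=> 1)) => [|k _]; last by rewrite subrr mul0r cos0.
  by rewrite sumr_const card_ord.
Qed.

Let sum_delta (a : 'I_N) : \sum_(b < N) ((a == b :> nat)%:R : R) = 1.
Proof.
rewrite (bigD1 a)//= eqxx big1 ?addr0// => b ba.
by rewrite eq_sym (_ : (_ == _) = false)//; apply/negbTE.
Qed.

(** The kernel is a partition of unity, whatever the shift [x] of the nodes. *)
Lemma fejer_sum_nodes : \sum_(k < N.*2) fejer N (node k) = N.*2%:R.
Proof.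
rewrite -mulr_sumr exchange_big /=.
under eq_bigr do rewrite exchange_big /=.
rewrite (eq_bigr (fun=> N.*2%:R)) => [|a _].
  rewrite sumr_const card_ord -[X in _ * X]mulr_natl mulrA mulVf ?mul1r//.
  by rewrite gt_eqF.
under eq_bigr => b _.
  rewrite cos_sum_nodes; last 2 first.
  - by rewrite (leq_trans (ltn_ord a))// -addnn addnA leq_addl.
  - by rewrite (leq_trans (ltn_ord b))// -addnn addnA leq_addl.
  over.
by rewrite -mulr_suml sum_delta mul1r.
Qed.

Let sum_delta_succ : \sum_(a < N) \sum_(b < N) ((a.+1 == b :> nat)%:R : R) = N%:R - 1.
Proof.
case: N N0 => // M _; rewrite big_ord_recr /= [X in _ + X]big1 ?addr0; last first.
  by move=> b _; rewrite gtn_eqF// ltn_ord.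
rewrite (eq_bigr (fun=> 1)) => [|a _].
  by rewrite sumr_const card_ord -natr1 addrK.
rewrite (bigD1 (lift ord0 a))//= eqxx big1 ?addr0// => b ba.
rewrite (_ : (_ == _) = false)//; apply/negbTE; apply: contra ba => /eqP ab.
by apply/eqP/val_inj; rewrite /= -ab.
Qed.

(** The spread of the kernel around 0, which is [1 / N] after normalization
    by the total mass [2 N]. *)
Lemma fejer_variance_nodes :
  \sum_(k < N.*2) fejer N (node k) * (1 - cos (node k)) = 2.
Proof.
under eq_bigr do rewrite mulrBr mulr1.
rewrite big_split /= fejer_sum_nodes sumrN.
rewrite (_ : \sum_(k < N.*2) fejer N (node k) * cos (node k) = N.*2%:R - 2); last first.
  transitivity ((N%:R^-1 : R) * (2^-1 * \sum_(a < N) \sum_(b < N) (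
      (a.+1 == b :> nat)%:R * N.*2%:R + (b.+1 == a :> nat)%:R * N.*2%:R))).
    under eq_bigr do rewrite /fejer -mulrA mulr_suml.
    rewrite -mulr_sumr; congr (_ * _); rewrite exchange_big /= mulr_sumr.
    apply: eq_bigr => a _; under eq_bigr do rewrite mulr_suml.
    rewrite exchange_big mulr_sumr /=; apply: eq_bigr => b _.
    have aN := ltn_ord a; have bN := ltn_ord b.
    rewrite [(b.+1 == a :> nat)]eq_sym.
    rewrite -(@cos_sum_nodes a.+1 b) -?(@cos_sum_nodes a b.+1) -?addnn; try lia.
    rewrite -big_split mulr_sumr; apply: eq_bigr => k _ /=.
    rewrite -[a.+1%:R]natr1 -[b.+1%:R]natr1.
    rewrite (_ : (a%:R + 1 - b%:R) * node k = (a%:R - b%:R) * node k + node k); last by ring.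
    rewrite (_ : (a%:R - (b%:R + 1)) * node k = (a%:R - b%:R) * node k - node k); last by ring.
    by move: (node k) ((a%:R - b%:R) * node k) => u v; rewrite cosD cosB; field.
  under eq_bigr do rewrite big_split/= -!mulr_suml.
  rewrite big_split /= -!mulr_suml [X in _ + X * _]exchange_big /= !sum_delta_succ.
  by rewrite N2E; field; rewrite gt_eqF.
by rewrite opprB addrC subrK.
Qed.

End fejer.

(** * Regularization of a positive definite function *)

Section regularization.
Context {R : realType}.

(** The tent function [1 - |k - N| / N] on [0, 2 N), written as [1 / N] times
    the number of pairs [(a, b)] below [N] with [k = a + N - b]. *)
Definition tent (N k : nat) : R :=
  N%:R^-1 * \sum_(a < N) \sum_(b < N) ((k == a + N - b)%N)%:R.

Lemma tent_ge0 N k : 0 <= tent N k.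
Proof.
by rewrite mulr_ge0 ?invr_ge0//; apply: sumr_ge0 => a _; apply: sumr_ge0.
Qed.

Let tent_inner N k (a : 'I_N) :
  \sum_(b < N) ((k == a + N - b)%N)%:R = ((a < k)%N && (k <= a + N)%N)%:R :> R.
Proof.
have aN := ltn_ord a.
have [h|h] := boolP (_ && _).
  have kN : (a + N - k < N)%N by lia.
  rewrite (bigD1 (Ordinal kN))//= (_ : (_ == _) = true); last by apply/eqP; lia.
  rewrite big1 ?addr0// => b bk; rewrite (_ : (_ == _) = false)//; apply/negbTE.
  by apply: contra bk => /eqP kb; apply/eqP/val_inj => /=; lia.
rewrite big1// => b _; have bN := ltn_ord b.
rewrite (_ : (_ == _) = false)//; apply/negbTE; apply: contra h => /eqP ->; lia.
Qed.

Lemma tent_le1 N k : tent N k <= 1.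
Proof.
have [->|N0] := posnP N; first by rewrite /tent big_ord0 mulr0.
rewrite /tent mulrC ler_pdivrMr ?ltr0n// mul1r.
rewrite -[leRHS](_ : \sum_(a < N) 1 = _); last by rewrite sumr_const card_ord.
by apply: ler_sum => a _; rewrite tent_inner lern1; case: (_ && _).
Qed.

Lemma tent_ge N k : (0 < N)%N -> 1 - `|k%:R - N%:R| / N%:R <= tent N k.
Proof.
move=> N0; have N0' : (0 : R) < N%:R by rewrite ltr0n.
rewrite -(ler_pM2l N0') mulrBr mulr1 mulrCA divff ?gt_eqF// mulr1.
rewrite /tent mulrA divff ?gt_eqF// mul1r.
under eq_bigr do rewrite tent_inner.
rewrite -natr_sum.
have h1 m M : (\sum_(a < M) (a < m) <= m)%N.
  elim: M m => [|M IH] m; first by rewrite big_ord0.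
  rewrite big_ord_recl /=; case: m => [|m]; first by rewrite big1.
  by rewrite /= -[m.+1]add1n leq_add// IH.
have h2 m M : (\sum_(a < M) (m <= a) <= M - m)%N.
  elim: M => [|M IH]; first by rewrite big_ord0.
  rewrite big_ord_recr /=; move: (\sum_(_ < M) _)%N IH => s IH.
  by case: leqP => mM /=; lia.
have h3 : (N <= \sum_(a < N) ((a < k) && (k <= a + N)) + ((k - N) + (N - k)))%N.
  apply: (@leq_trans (\sum_(a < N) ((a < k) && (k <= a + N)) +
     (\sum_(a < N) (a < k - N) + \sum_(a < N) (k <= a)))%N); last first.
    by rewrite leq_add2l leq_add.
  rewrite -!big_split /= -[leqLHS](_ : \sum_(a < N) 1 = _)%N; last first.
    by rewrite sum_nat_const card_ord muln1.
  by apply: leq_sum => a _; lia.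
have -> : `|k%:R - N%:R| = ((k - N) + (N - k))%:R :> R.
  have [kN|Nk] := leqP k N.
    by rewrite distrC ger0_norm ?subr_ge0 ?ler_nat// -natrB//; congr _%:R; lia.
  by rewrite ger0_norm ?subr_ge0 ?ler_nat ?(ltnW Nk)// -natrB ?(ltnW Nk)//; congr _%:R; lia.
by rewrite lerBlDr -natrD ler_nat.
Qed.

(** The weight of the k-th node for an angle [y]; the shift by [pi] centres the
    range of the nodes at 0. *)
Definition fejer_weight (N : nat) (y : R) (k : nat) : R :=
  N.*2%:R^-1 * fejer N (y + pi - k%:R * (pi / N%:R)).

Lemma fejer_weight_ge0 N y k : 0 <= fejer_weight N y k.
Proof. by rewrite mulr_ge0 ?invr_ge0// fejer_ge0. Qed.

Context {d : nat}.
Implicit Types (x : 'rV[R]_d) (h : 'rV[R]_d -> R).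

(** The grid points of the box [[-l, l)^d], of mesh [l / N]. *)
Definition node (l : R) (N : nat) (k : {ffun 'I_d -> 'I_N.*2}) : 'rV[R]_d :=
  \row_i (l * ((k i)%:R - N%:R) / N%:R).

(** The average of [h], damped by the tents, over the grid points, weighted by
    a Fejer kernel of period [2 l] centred at [x]. *)
Definition regularization (l : R) (N : nat) h x : R :=
  \sum_(k : {ffun 'I_d -> 'I_N.*2}) (\prod_i fejer_weight N (pi * x ord0 i / l) (k i)) *
         ((\prod_i tent N (k i)) * h (node l k)).

(** A sum damped by the tents is a double sum over differences of points, the
    form to which positive definiteness applies. *)
Lemma tent_node_sum (l : R) (N : nat) (f : 'rV[R]_d -> R) : (0 < N)%N ->
  \sum_(k : {ffun 'I_d -> 'I_N.*2}) (\prod_i tent N (k i)) * f (node l k) =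
  N%:R^-1 ^+ d * \sum_(u : {ffun 'I_d -> 'I_N}) \sum_(v : {ffun 'I_d -> 'I_N})
    f (\row_i (l * (u i)%:R / N%:R) - \row_i (l * (v i)%:R / N%:R)).
Proof.
move=> N0.
pose delta (k : {ffun 'I_d -> 'I_N.*2}) (u v : {ffun 'I_d -> 'I_N}) : R :=
  \prod_i (k i == u i + N - v i :> nat)%N%:R.
have tentE (k : {ffun 'I_d -> 'I_N.*2}) :
    \prod_i tent N (k i) = N%:R^-1 ^+ d * \sum_u \sum_v delta k u v.
  rewrite big_split /= prodr_const card_ord; congr (_ * _).
  by rewrite bigA_distr_bigA; apply: eq_bigr => u _; rewrite bigA_distr_bigA.
under eq_bigr do rewrite tentE -mulrA mulr_suml.
rewrite -mulr_sumr exchange_big; congr (_ * _); apply: eq_bigr => u _ /=.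
under eq_bigr do rewrite mulr_suml.
rewrite exchange_big; apply: eq_bigr => v _ /=.
have kN i : (u i + N - v i < N.*2)%N by have := ltn_ord (u i); lia.
pose k0 := [ffun i => Ordinal (kN i)].
rewrite (bigD1 k0)//= [delta _ _ _]big1 ?mul1r; last first.
  by move=> i _; rewrite ffunE /= eqxx.
rewrite big1 ?addr0 => [|k kk0].
  congr f; apply/rowP => i; rewrite !mxE ffunE /= natrB; last first.
    by rewrite ltnW// ltn_addl.
  by rewrite natrD; field; rewrite pnatr_eq0 -lt0n.
have [i ki] : exists i, k i != k0 i.
  apply/existsP; rewrite -negb_forall; apply: contra kk0 => /forallP kk0.
  by apply/eqP/ffunP => i; exact/eqP.
rewrite /delta (bigD1 i)//= (_ : (_ == _) = false) ?mul0r//.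
by apply/negbTE; apply: contra ki => /eqP e; apply/eqP/val_inj; rewrite ffunE.
Qed.

Section error.
Variables (l : R) (N : nat).
Hypotheses (l0 : 0 < l) (N0 : (0 < N)%N).
Variable x : 'rV[R]_d.

Let y i := pi * x ord0 i / l.
Let wt (k : {ffun 'I_d -> 'I_N.*2}) := \prod_i fejer_weight N (y i) (k i).
(* The angle [pi (x_i - z_i) / l] at the grid point [z] of index [k]. *)
Let phase i (k : 'I_N.*2) := y i + pi - k%:R * (pi / N%:R).

Let N2 : N.*2%:R != 0 :> R. Proof. by rewrite pnatr_eq0 double_eq0 -lt0n. Qed.
Let NR : N%:R != 0 :> R. Proof. by rewrite pnatr_eq0 -lt0n. Qed.

Let weight1_sum i : \sum_(k < N.*2) fejer_weight N (y i) k = 1.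
Proof. by rewrite -mulr_sumr fejer_sum_nodes// mulVf. Qed.

Let regularizationE h : regularization l N h x =
  \sum_k wt k * ((\prod_i tent N (k i)) * h (node l k)).
Proof. by []. Qed.

Lemma regularization_weight_ge0 k : 0 <= wt k.
Proof. by apply: prodr_ge0 => i _; exact: fejer_weight_ge0. Qed.

Lemma regularization_weight_sum : \sum_k wt k = 1.
Proof.
rewrite -(bigA_distr_bigA (fun i (k : 'I_N.*2) => fejer_weight N (y i) k)).
by rewrite big1.
Qed.

Lemma regularization_weight_variance j :
  \sum_k wt k * (1 - cos (phase j (k j))) = N%:R^-1.
Proof.
pose F i (k : 'I_N.*2) := fejer_weight N (y i) k *
  (if i == j then 1 - cos (phase i k) else 1).
rewrite (eq_bigr (fun k : {ffun 'I_d -> 'I_N.*2} => \prod_i F i (k i))) => [|k _].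
  rewrite -(bigA_distr_bigA F) (bigD1 j)//= [X in _ * X]big1 ?mulr1 => [|i ij].
    rewrite /F eqxx /fejer_weight.
    under eq_bigr do rewrite -mulrA.
    by rewrite -mulr_sumr fejer_variance_nodes// -mul2n natrM; field.
  by rewrite /F (negbTE ij); under eq_bigr do rewrite mulr1.
rewrite big_split /=; congr (_ * _).
by rewrite (bigD1 j)//= eqxx big1 ?mulr1// => i /negbTE ->.
Qed.

Lemma regularization_bounded h (M : R) : (forall z, `|h z| <= M) ->
  `|regularization l N h x| <= M.
Proof.
move=> hM; rewrite regularizationE; apply: le_trans (ler_norm_sum _ _ _) _.
rewrite [leRHS](_ : M = \sum_k wt k * M); last first.
  by rewrite -mulr_suml regularization_weight_sum mul1r.
apply: ler_sum => k _.
rewrite normrM (ger0_norm (regularization_weight_ge0 k)).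
apply: ler_wpM2l; first exact: regularization_weight_ge0.
have t0 : 0 <= \prod_i tent N (k i) by apply: prodr_ge0 => i _; exact: tent_ge0.
rewrite normrM -[M]mul1r ler_pM// (ger0_norm t0).
by apply: prodr_ile1 => i _; rewrite tent_ge0 tent_le1.
Qed.

Let prod_ge (I : Type) (r : seq I) (t : I -> R) : (forall i, 0 <= t i <= 1) ->
  1 - \sum_(i <- r) (1 - t i) <= \prod_(i <- r) t i <= 1.
Proof.
move=> t01; elim: r => [|i r /andP[IH1 IH2]]; first by rewrite !big_nil subr0 lexx.
have := t01 i; rewrite !big_cons; move: (\sum_(_ <- _) _) (\prod_(_ <- _) _) IH1 IH2.
move=> s p h1 h2 /andP[h3 h4]; apply/andP; split; last by nra.
have [p0|p0] := leP 0 p; nra.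
Qed.

(* Outside of [-s, s], modulo [2 pi], the cosine is at most [cos s]. *)
Let cos_le (s p : R) : 0 <= s -> s <= `|p| -> `|p| <= pi *+ 2 - s -> cos p <= cos s.
Proof.
move=> s0 sp ps; rewrite -(cos_norm p).
have p0 := pi_gt0 R; rewrite mulr2n in ps.
have [le|gt] := leP `|p| pi.
  by rewrite leNgt ltr_cos ?in_itv/= -?leNgt//; apply/andP; split; lra.
rewrite -cosN -(cosD2pi (- `|p|)) leNgt ltr_cos ?in_itv/= -?leNgt ?mulr2n//.
- by lra.
- by apply/andP; split; lra.
- by apply/andP; split; lra.
Qed.

(** The three terms bound the oscillation of [h] at distance [r] of [x], the
    damping by the tents there, and the mass that the kernel leaves at
    distance more than [r]. *)
Lemma regularization_error h (e r B : R) : positive_definite h ->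
  0 <= e -> 0 < r -> 0 <= B -> (forall i, `|x ord0 i| <= B) -> B + r <= l ->
  (forall z : 'rV[R]_d, (forall i, `|z ord0 i - x ord0 i| < r) -> `|h z - h x| <= e) ->
  `|regularization l N h x - h x| <=
    e + h 0 * (d%:R * ((B + r) / l)) +
    2 * h 0 * (d%:R * (N%:R^-1 / (1 - cos (pi * r / l)))).
Proof.
move=> hpd e0 r0 B0 xB Brl near_x.
have p0 := pi_gt0 R.
have h0 := positive_definite_ge0 hpd.
have hle z := positive_definite_le0 z hpd.
pose s := pi * r / l.
have s0 : 0 < s by rewrite divr_gt0// mulr_gt0.
have spi : s <= pi by rewrite ler_pdivrMr// ler_pM2l//; lra.
have c0 : 0 < 1 - cos s.
  rewrite subr_gt0 -[ltRHS](cos0 R) ltr_cos// in_itv/= ?lexx ?(ltW p0)//.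
  by rewrite (ltW s0).
have -> : h x = \sum_k wt k * h x.
  by rewrite -mulr_suml regularization_weight_sum mul1r.
rewrite regularizationE -sumrB; apply: le_trans (ler_norm_sum _ _ _) _.
have -> : e + h 0 * (d%:R * ((B + r) / l)) +
    2 * h 0 * (d%:R * (N%:R^-1 / (1 - cos s))) =
    \sum_k wt k * (e + h 0 * (d%:R * ((B + r) / l)) +
      2 * h 0 * \sum_i ((1 - cos (phase i (k i))) / (1 - cos s))).
  move: (e + _) (2 * h 0) => A c.
  rewrite (eq_bigr (fun k => wt k * A + c *
      \sum_i wt k * (1 - cos (phase i (k i))) / (1 - cos s))) => [|k _]; last first.
    rewrite mulrDr [X in _ + X]mulrCA; congr (_ + c * _).
    by rewrite mulr_sumr; apply: eq_bigr => i _; rewrite mulrA.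
  rewrite big_split /= -mulr_suml regularization_weight_sum mul1r; congr (_ + _).
  rewrite -mulr_sumr exchange_big /=; congr (_ * _).
  rewrite (eq_bigr (fun=> N%:R^-1 / (1 - cos s))) => [|i _].
    by rewrite sumr_const card_ord mulr_natl.
  by rewrite -mulr_suml regularization_weight_variance.
apply: ler_sum => k _; rewrite -mulrBr normrM.
rewrite (ger0_norm (regularization_weight_ge0 k)).
apply: ler_wpM2l; first exact: regularization_weight_ge0.
set z := node l k; set t := \prod_i _.
have t01 i : 0 <= tent N (k i) <= 1 by rewrite tent_ge0 tent_le1.
have /andP[tge tle] := prod_ge (index_enum 'I_d) t01.
rewrite -/t in tge tle.
have tge0 : 0 <= t by apply: prodr_ge0 => i _; exact: tent_ge0.
have zE i : z ord0 i = l * ((k i)%:R - N%:R) / N%:R by rewrite mxE.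
have phaseE i : phase i (k i) = pi / l * (x ord0 i - z ord0 i).
  by rewrite zE /phase /y; field; rewrite NR gt_eqF.
have zl i : `|z ord0 i| <= l.
  rewrite zE -mulrA normrM (gtr0_norm l0) ler_piMr ?(ltW l0)//.
  rewrite normrM normfV [X in _ / X]ger0_norm// ler_pdivrMr ?ltr0n// mul1r.
  have kN : (k i)%:R <= N%:R + N%:R :> R.
    by rewrite -natrD ler_nat addnn ltnW// ltn_ord.
  by rewrite ler_norml; apply/andP; split; have := ler0n R (k i); lra.
have var0 : 0 <= \sum_i (1 - cos (phase i (k i))) / (1 - cos s).
  by apply: sumr_ge0 => i _; rewrite divr_ge0 ?(ltW c0)// subr_ge0 cos_le1.
have bias0 : 0 <= h 0 * (d%:R * ((B + r) / l)).
  by rewrite mulr_ge0// mulr_ge0// divr_ge0 ?(ltW l0)//; lra.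
case: (pselect (forall i, `|z ord0 i - x ord0 i| < r)) => [zx|nzx].
  have -> : t * h z - h x = (h z - h x) - (1 - t) * h z by ring.
  apply: le_trans (ler_normB _ _) _.
  apply: (@le_trans _ _ (e + h 0 * (d%:R * ((B + r) / l)))); last first.
    by rewrite lerDl mulr_ge0// mulr_ge0.
  apply: lerD; first exact: near_x.
  rewrite normrM mulrC; apply: ler_pM => //.
  rewrite ger0_norm; last by lra.
  apply: (@le_trans _ _ (\sum_(i < d) (B + r) / l)); last first.
    by rewrite sumr_const card_ord mulr_natl.
  apply: (@le_trans _ _ (\sum_(i < d) (1 - tent N (k i)))); first by lra.
  apply: ler_sum => i _.
  have := @tent_ge N (k i) N0.
  suff : `|(k i)%:R - N%:R| / N%:R <= (B + r) / l by lra.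
  rewrite (_ : `|(k i)%:R - N%:R| / N%:R = `|z ord0 i| / l).
    rewrite ler_pM2r ?invr_gt0// -[z ord0 i](subrK (x ord0 i)) addrC.
    by apply: le_trans (ler_normD _ _) _; have := zx i; have := xB i; lra.
  rewrite zE -mulrA normrM (gtr0_norm l0) mulrAC divff ?gt_eqF// mul1r.
  by rewrite normrM normfV [`|N%:R|]ger0_norm.
(* Away from [x] the trivial bound [2 h(0)] suffices, by the Chebyshev
   inequality for [1 - cos]. *)
have [i far] : exists i, r <= `|z ord0 i - x ord0 i|.
  apply: contrapT => far; apply: nzx => i; rewrite ltNge; apply/negP => zxi.
  by apply: far; exists i.
apply: (@le_trans _ _ (2 * h 0)).
  apply: le_trans (ler_normB _ _) _.
  rewrite normrM (ger0_norm tge0).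
  have := hle z; have := hle x; have := normr_ge0 (h z); nra.
apply: (@le_trans _ _ (2 * h 0 * \sum_i ((1 - cos (phase i (k i))) / (1 - cos s)))); last by lra.
rewrite ler_peMr// ?mulr_ge0// (bigD1 i)//=.
apply: (@le_trans _ _ ((1 - cos (phase i (k i))) / (1 - cos s))); last first.
  rewrite lerDl; apply: sumr_ge0 => j _.
  by rewrite divr_ge0 ?(ltW c0)// subr_ge0 cos_le1.
rewrite ler_pdivlMr// mul1r lerD2l lerN2; apply: cos_le; first exact: ltW.
  rewrite phaseE normrM gtr0_norm ?divr_gt0// distrC /s mulrAC.
  by rewrite ler_pM2l// divr_gt0.
rewrite phaseE normrM gtr0_norm ?divr_gt0//.
rewrite (_ : pi *+ 2 - s = pi / l * (2 * l - r)); last first.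
  by rewrite /s mulr2n; field; rewrite gt_eqF.
rewrite ler_pM2l ?divr_gt0//; apply: le_trans (ler_normB _ _) _.
have := xB i; have := zl i; lra.
Qed.

End error.

End regularization.

(** * Convergence of the regularizations *)

Section regularization_limit.
Context {R : realType}.

Lemma continuous_rV_measurable m n (f : 'M[R]_(m, n) -> R) :
  continuous f -> measurable_fun setT f.
Proof.
move=> cf; apply: (measurability _ (measurable_realfun.RGenOpens.measurableE R)).
move=> _ [_ [a [b ->]] <-]; rewrite setTI; apply: sub_sigma_algebra.
by move/continuousP : cf; apply; exact: interval_open.
Qed.

Lemma mean_cvg d (T : measurableType d) (P : probability T R)
    (f_ : nat -> T -> R) (f : T -> R) (M : R) :
  (forall n, bdm (f_ n)) -> bdm f -> (forall n w, `|f_ n w| <= M) ->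
  (forall w, f_ n w @[n --> \oo] --> f w) ->
  mean P (f_ n) @[n --> \oo] --> mean P f.
Proof.
move=> bf_ bf fM f_f.
have [] := @dominated_convergence _ T R P setT measurableT
  (fun n => EFin \o f_ n) (EFin \o f) (fun=> M%:E).
- by move=> n; have [mf _] := bf_ n; exact/measurable_EFinP.
- by have [mf _] := bf; exact/measurable_EFinP.
- by apply: aeW => w _; apply: cvg_EFin; [exact: nearW|exact: f_f].
- exact: (bdm_integrable P (bdm_cst _ M)).
- by apply: aeW => w n _; rewrite lee_fin.
move=> _ _ cvgI; apply: fine_cvg; rewrite fineK//.
exact/integrable_fin_num/bdm_integrable.
Qed.

(** The order [N] of the kernel on the box of half-width [l = n + 1]: its spread,
    relative to the angle [pi / l^2], that is to the distance [1 / l], is at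
    most [1 / l]. *)
Lemma regularization_scale (n : nat) : exists N : nat, (0 < N)%N /\
  n.+1%:R <= N%:R * (1 - cos (pi / n.+1%:R ^+ 2)) :> R.
Proof.
set l : R := n.+1%:R; have p0 := pi_gt0 R.
have l1 : 1 <= l by rewrite ler1n.
have l2 : 1 <= l ^+ 2 by rewrite expr_ge1// (le_trans _ l1).
have l2p : 0 < l ^+ 2 by lra.
have c0 : 0 < 1 - cos (pi / l ^+ 2).
  rewrite subr_gt0 -[ltRHS](cos0 R) ltr_cos ?divr_gt0// in_itv/= ?lexx ?(ltW p0)//.
  by rewrite divr_ge0 ?(ltW p0) ?(ltW l2p)//= ler_pdivrMr// ler_peMr// ltW.
exists (Num.bound (l / (1 - cos (pi / l ^+ 2)))).
have lc0 : 0 < l / (1 - cos (pi / l ^+ 2)) by rewrite divr_gt0//; lra.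
have := archi_boundP (ltW lc0) => lcN; split.
  by rewrite -(ltr_nat R) (lt_trans lc0).
by rewrite -ler_pdivrMr// ltW.
Qed.

Lemma regularization_cvg : exists N : nat -> nat, (forall n, (0 < N n)%N) /\
  forall d (h : 'rV[R]_d -> R), continuous h -> positive_definite h ->
  forall x, regularization n.+1%:R (N n) h x @[n --> \oo] --> h x.
Proof.
have /choice[N HN] := regularization_scale.
exists N; split=> [n|d h ch hpd x]; first exact: (HN n).1.
apply/cvgrPdist_le => e e0.
have /(_ _ (nbhsx_ballx (h x) _ (divr_gt0 e0 (ltr0Sn R 1)))) := ch x.
move=> /nbhs_ballP[r /= r0 near_x].
pose B := \sum_i `|x ord0 i|.
have B0 : 0 <= B by apply: sumr_ge0.
have xB i : `|x ord0 i| <= B by rewrite /B (bigD1 i)//= lerDl sumr_ge0.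
have h0 := positive_definite_ge0 hpd.
have p0 := pi_gt0 R.
pose K := h 0 * d%:R * (B + r) + 2 * h 0 * d%:R.
have K0 : 0 <= K by rewrite addr_ge0// !mulr_ge0// ?addr_ge0// ltW.
near=> n.
set l : R := n.+1%:R.
have l0 : 0 < l by rewrite ltr0n.
have nl : n%:R <= l by rewrite ler_nat.
have Brl : B + r <= l by apply: le_trans nl; near: n; exact: nbhs_infty_ger.
have rl : r^-1 <= l by apply: le_trans nl; near: n; exact: nbhs_infty_ger.
have Kel : K / (e / 2) <= l by apply: le_trans nl; near: n; exact: nbhs_infty_ger.
rewrite distrC.
apply: le_trans (@regularization_error R d l (N n) l0 (HN n).1 x h (e / 2) r B
  hpd _ r0 B0 xB Brl _) _; first by rewrite divr_ge0 ?(ltW e0).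
  move=> z zx; rewrite ltW// distrC; apply: near_x; split=> // i j.
  by rewrite (ord1 i) /ball/= distrC.
have lr : 1 <= r * l by rewrite -ler_pdivrMl// mulr1.
have c1 : 1 - cos (pi / l ^+ 2) <= 1 - cos (pi * r / l).
  rewrite lerD2l lerN2 leNgt ltr_cos ?in_itv/=.
  - rewrite -leNgt ler_pdivrMr ?exprn_gt0// expr2 mulrA divfK ?gt_eqF//.
    by rewrite -mulrA ler_peMr// ltW.
  - rewrite divr_ge0 ?mulr_ge0 ?(ltW p0) ?(ltW l0) ?(ltW r0)//=.
    by rewrite ler_pdivrMr// ler_pM2l//; lra.
  - rewrite divr_ge0 ?(ltW p0) ?exprn_ge0 ?(ltW l0)//= ler_pdivrMr ?exprn_gt0//.
    by rewrite ler_peMr ?(ltW p0)// expr_ge1// ?(ltW l0)// ler1n.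
have Nl : (N n)%:R^-1 / (1 - cos (pi * r / l)) <= l^-1.
  have Nc := (HN n).2; rewrite -/l in Nc.
  rewrite -invfM lef_pV2 ?posrE//.
    by apply: le_trans Nc _; rewrite ler_wpM2l.
  by apply: lt_le_trans l0 _; apply: le_trans Nc _; rewrite ler_wpM2l.
rewrite [leRHS](_ : e = e / 2 + e / 2); last by field.
rewrite -addrA lerD2l.
apply: (@le_trans _ _ (K / l)).
  rewrite /K [leRHS]mulrDl; apply: lerD; first by rewrite !mulrA.
  by rewrite -[leRHS]mulrA ler_wpM2l ?mulr_ge0// ler_wpM2l.
by rewrite ler_pdivrMr// mulrC -ler_pdivrMr// divr_gt0.
Unshelve. all: by end_near.
Qed.

End regularization_limit.

(** * Integrals of positive definite functions *)

Section positivity.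
Context {R : realType} {d : nat} dT (T : measurableType dT) (P : probability T R).
Variables (I : finType) (c : I -> R) (Y : I -> T -> 'rV[R]_d).
Hypothesis mY : forall i, measurable_fun setT (Y i).

Lemma bdm_comp_continuous (f : 'rV[R]_d -> R) (M : R) i : continuous f ->
  (forall x, `|f x| <= M) -> bdm (fun w => f (Y i w)).
Proof.
move=> cf fM; apply: bdm_comp => //; split; last by exists M.
exact: continuous_rV_measurable.
Qed.

Let bdm_cos s i : bdm (fun w => cos (inner s (Y i w))).
Proof.
apply: (@bdm_comp_continuous (fun x => cos (inner s x)) 1) => [|x].
  exact: continuous_cos_inner.
exact: cos_max.
Qed.

Let bdm_sin s i : bdm (fun w => sin (inner s (Y i w))).
Proof.
apply: (@bdm_comp_continuous (fun x => sin (inner s x)) 1) => [x|x].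
  by apply: continuous_comp; [exact: continuous_inner|exact: continuous_sin].
exact: sin_max.
Qed.

Let bdm_cone f z i : cosine_cone f -> bdm (fun w => f (Y i w - z)).
Proof.
elim=> {f} [s||f1 f2 _ b1 _ b2|a f a0 _ bf].
- under eq_fun do rewrite innerBr cosB.
  by apply: bdmD; apply: bdmM => //; exact: bdm_cst.
- exact: bdm_cst.
- exact: bdmD.
- exact: bdmZ.
Qed.

Hypothesis cos_ge0 : forall s, 0 <= \sum_i c i * mean P (fun w => cos (inner s (Y i w))).
Hypothesis sin_eq0 : forall s i, mean P (fun w => sin (inner s (Y i w))) = 0.

(* The property is linear in [f], so it is enough to check it on cosines,
   where the sum factors by the addition formula. *)
Let cone_ge0 h (l : R) N f : positive_definite h -> (0 < N)%N -> cosine_cone f ->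
  0 <= \sum_(k : {ffun 'I_d -> 'I_N.*2})
    (\prod_i tent N (k i)) * (h (node l k) * \sum_i c i * mean P (fun w => f (Y i w - node l k))).
Proof.
move=> hpd N0; elim=> {f} [s||f1 f2 c1 p1 c2 p2|a f a0 cf pf].
- rewrite (eq_bigr (fun k : {ffun 'I_d -> 'I_N.*2} =>
    (\sum_i c i * mean P (fun w => cos (inner s (Y i w)))) *
    ((\prod_i tent N (k i)) * (h (node l k) * cos (inner s (node l k)))))) => [|k _].
    rewrite -mulr_sumr mulr_ge0// (tent_node_sum l (fun z => h z * cos (inner s z)))//.
    rewrite mulr_ge0//.
    exact: (positive_definite_cos_sum
      (fun u : {ffun 'I_d -> 'I_N} => \row_i (l * (u i)%:R / N%:R))).
  set z := node l k; rewrite [RHS]mulrCA; congr (_ * _).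
  rewrite [RHS]mulrCA; congr (_ * _); rewrite mulr_suml; apply: eq_bigr => i _.
  rewrite -mulrA; congr (_ * _).
  transitivity (mean P (fun w => cos (inner s z) * cos (inner s (Y i w)) +
      sin (inner s z) * sin (inner s (Y i w)))).
    by congr mean; apply/funext => w; rewrite innerBr cosB; ring.
  rewrite meanD; [|exact: bdmZ|exact: bdmZ].
  by rewrite !meanZ// sin_eq0 mulr0 addr0 mulrC.
- by apply: sumr_ge0 => k _; rewrite [\sum_i _]big1 ?mulr0// => i _; rewrite mean_cst mulr0.
- rewrite [leRHS](_ : _ = (\sum_(k : {ffun 'I_d -> 'I_N.*2})
    (\prod_i tent N (k i)) * (h (node l k) * \sum_i c i * mean P (fun w => f1 (Y i w - node l k)))) + (\sum_(k : {ffun 'I_d -> 'I_N.*2})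
    (\prod_i tent N (k i)) * (h (node l k) * \sum_i c i * mean P (fun w => f2 (Y i w - node l k))))); first exact: addr_ge0.
  rewrite -big_split; apply: eq_bigr => k _ /=; rewrite -!mulrDr -big_split.
  congr (_ * (_ * _)); apply: eq_bigr => i _ /=.
  by rewrite meanD; [rewrite mulrDr|exact: bdm_cone|exact: bdm_cone].
- rewrite [leRHS](_ : _ = a * (\sum_(k : {ffun 'I_d -> 'I_N.*2})
    (\prod_i tent N (k i)) * (h (node l k) * \sum_i c i * mean P (fun w => f (Y i w - node l k))))); first exact: mulr_ge0.
  rewrite mulr_sumr; apply: eq_bigr => k _; rewrite [RHS]mulrCA; congr (_ * _).
  rewrite [RHS]mulrCA; congr (_ * _); rewrite mulr_sumr; apply: eq_bigr => i _.
  by rewrite meanZ; [rewrite mulrCA|exact: bdm_cone].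
Qed.

(* The normalized Fejer kernel on R^d, of period [2 l] in each coordinate. *)
Let kernel (l : R) N (x : 'rV[R]_d) := \prod_i (N.*2%:R^-1 * fejer N (pi / l * x ord0 i)).

Let kernel_cone l N : cosine_cone (kernel l N).
Proof.
apply: cosine_cone_prod => i; apply: cosine_coneZ; first by rewrite invr_ge0.
exact: cosine_cone_fejer.
Qed.

Let regularizationE l N h x : (0 < N)%N -> l != 0 -> regularization l N h x =
  \sum_(k : {ffun 'I_d -> 'I_N.*2}) (\prod_i tent N (k i)) *
    (h (node l k) * kernel l N (x - node l k)).
Proof.
move=> N0 l0; apply: eq_bigr => k _; rewrite mulrC -mulrA; congr (_ * (_ * _)).
apply: eq_bigr => i _; rewrite /fejer_weight; congr (_ * fejer N _).
by rewrite !mxE; field; rewrite l0 pnatr_eq0 -lt0n N0.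
Qed.

(** A finite combination of laws with vanishing sine transforms and nonnegative
    cosine transform integrates continuous positive definite functions to
    nonnegative numbers. *)
Lemma mean_positive_definite_ge0 h : continuous h -> positive_definite h ->
  0 <= \sum_i c i * mean P (fun w => h (Y i w)).
Proof.
move=> ch hpd.
have [N [N0 Ncvg]] := @regularization_cvg R.
pose rg n x := regularization n.+1%:R (N n) h x.
have n0 n : n.+1%:R != 0 :> R by rewrite pnatr_eq0.
have hle x := positive_definite_le0 x hpd.
have rgE n i w : rg n (Y i w) =
    \sum_(k : {ffun 'I_d -> 'I_(N n).*2}) ((\prod_i tent (N n) (k i)) * h (node n.+1%:R k)) *
      kernel n.+1%:R (N n) (Y i w - node n.+1%:R k).
  by rewrite /rg regularizationE//; apply: eq_bigr => k _; rewrite mulrA.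
have bk n i (k : {ffun 'I_d -> 'I_(N n).*2}) :
    bdm (fun w => kernel n.+1%:R (N n) (Y i w - node n.+1%:R k)).
  exact: bdm_cone.
have brg n i : bdm (fun w => rg n (Y i w)).
  by under eq_fun do rewrite rgE; apply: bdm_sum => k; exact: bdmZ.
have bh i : bdm (fun w => h (Y i w)) by exact: bdm_comp_continuous.
have rg0 n : 0 <= \sum_i c i * mean P (fun w => rg n (Y i w)).
  rewrite [leRHS](_ : _ = \sum_(k : {ffun 'I_d -> 'I_(N n).*2})
      (\prod_i tent (N n) (k i)) * (h (node n.+1%:R k) *
    \sum_i c i * mean P (fun w => kernel n.+1%:R (N n) (Y i w - node n.+1%:R k)))).
    exact: cone_ge0.
  under [RHS]eq_bigr do rewrite mulrA mulr_sumr.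
  rewrite exchange_big; apply: eq_bigr => i _ /=.
  rewrite (_ : (fun w => _) = fun w => \sum_(k : {ffun 'I_d -> 'I_(N n).*2})
     ((\prod_i tent (N n) (k i)) * h (node n.+1%:R k)) *
      kernel n.+1%:R (N n) (Y i w - node n.+1%:R k)); last by apply/funext => w; exact: rgE.
  rewrite mean_sum => [|k]; last exact: bdmZ.
  by rewrite mulr_sumr; apply: eq_bigr => k _; rewrite meanZ// mulrCA.
have cvg_rg : \sum_i c i * mean P (fun w => rg n (Y i w)) @[n --> \oo] -->
    \sum_i c i * mean P (fun w => h (Y i w)).
  have addc : continuous (fun z : R * R => z.1 + z.2) by exact: add_continuous.
  apply: (cvg_big addc) => i _; apply: cvgMr.
  apply: (@mean_cvg _ _ _ _ _ _ (h 0)) => // [n w|w]; last exact: Ncvg.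
  exact: regularization_bounded.
rewrite -(cvg_lim _ cvg_rg)//; apply: limr_ge.
  by apply/cvg_ex; eexists; exact: cvg_rg.
exact: nearW.
Qed.

End positivity.

(** * The weighted inequality of arithmetic and geometric means *)

Section young.
Context {R : realType}.
Implicit Types A B l s : R.

Lemma weighted_young A B l s1 s2 : 0 <= A -> 0 <= B -> 0 < l < 1 ->
  0 < s1 -> 0 < s2 -> s1 `^ l * s2 `^ (1 - l) = 1 ->
  A `^ l * B `^ (1 - l) <= l * s1 * A + (1 - l) * s2 * B.
Proof.
move=> A0 B0 /andP[l0 l1] s10 s20 s12.
have l1' : 0 < 1 - l by rewrite subr_gt0.
have := @conjugate_powR R ((s1 * A) `^ l) ((s2 * B) `^ (1 - l)) l^-1 (1 - l)^-1.
rewrite !powR_ge0 !invr_gt0 l0 l1' !invrK addrC subrK -!powRrM.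
rewrite !mulfV ?gt_eqF// !powRr1 ?mulr_ge0 ?(ltW s10) ?(ltW s20)//.
move=> /(_ isT isT isT isT erefl).
rewrite !powRM ?(ltW s10) ?(ltW s20)// mulrACA s12 mul1r => /le_trans; apply.
by rewrite le_eqVlt; apply/orP; left; apply/eqP; ring.
Qed.

(** The weighted geometric mean is the infimum of the arithmetic means that
    bound it. *)
Lemma young_inf A B l c : 0 <= A -> 0 <= B -> 0 < l < 1 ->
  (forall s1 s2, 0 < s1 -> 0 < s2 -> s1 `^ l * s2 `^ (1 - l) = 1 ->
     c <= l * s1 * A + (1 - l) * s2 * B) ->
  c <= A `^ l * B `^ (1 - l).
Proof.
move=> A0 B0 /andP[l0 l1] cs.
have l1' : 0 < 1 - l by rewrite subr_gt0.
have powE x k : expR x `^ k = expR (k * x) by rewrite /powR gt_eqF ?expR_gt0// expRK.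
have small k : 0 <= k -> (forall e, 0 < e -> c <= k * e) -> c <= 0.
  move=> k0 ck; apply/ler_addgt0Pl => e e0; rewrite addr0.
  apply: le_trans (ck (e / (k + 1)) _) _; first by rewrite divr_gt0//; lra.
  rewrite mulrA ler_pdivrMr; last by lra.
  by rewrite mulrDr mulr1 mulrC lerDl ltW.
(* When [A] or [B] vanishes, the infimum is approached with the weight of the
   other one going to 0. *)
have [A_eq0|An0] := eqVneq A 0.
  rewrite A_eq0 powR0 ?gt_eqF// mul0r; apply: (small ((1 - l) * B)).
    by rewrite mulr_ge0// ltW.
  move=> e e0; apply: le_trans (cs (expR (- ((1 - l) / l * ln e))) e _ _ _) _ => //.
  - exact: expR_gt0.
  - rewrite powE -[e in X in _ * X](lnK e0) powE -expRD (_ : _ + _ = 0) ?expR0//.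
    by field; rewrite gt_eqF.
  - by rewrite A_eq0 mulr0 add0r mulrAC.
have [B_eq0|Bn0] := eqVneq B 0.
  rewrite B_eq0 powR0 ?gt_eqF// mulr0; apply: (small (l * A)).
    by rewrite mulr_ge0// ltW.
  move=> e e0; apply: le_trans (cs e (expR (- (l / (1 - l) * ln e))) _ _ _) _ => //.
  - exact: expR_gt0.
  - rewrite powE -[e in X in X * _](lnK e0) powE -expRD (_ : _ + _ = 0) ?expR0//.
    by field; rewrite gt_eqF.
  - by rewrite B_eq0 mulr0 addr0 mulrAC.
have Ap : 0 < A by rewrite lt_neqAle eq_sym An0.
have Bp : 0 < B by rewrite lt_neqAle eq_sym Bn0.
rewrite -(lnK Ap) -(lnK Bp) !powE -expRD.
(* These weights make both terms of the arithmetic mean proportional to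
   [A^l B^(1 - l)]. *)
apply: le_trans (cs (expR ((1 - l) * (ln B - ln A))) (expR (l * (ln A - ln B))) _ _ _) _.
- exact: expR_gt0.
- exact: expR_gt0.
- by rewrite !powE -expRD (_ : _ + _ = 0) ?expR0//; ring.
- rewrite -[A in X in X <= _](lnK Ap) -[B in X in X <= _](lnK Bp) !expRK.
  rewrite -!mulrA -!expRD le_eqVlt; apply/orP; left; apply/eqP.
  rewrite (_ : (1 - l) * (ln B - ln A) + ln A = l * ln A + (1 - l) * ln B); last by ring.
  rewrite (_ : l * (ln A - ln B) + ln B = l * ln A + (1 - l) * ln B); last by ring.
  by ring.
Qed.

Lemma powR_prod (I : Type) (r : seq I) (u : I -> R) l : (forall i, 0 <= u i) ->
  (\prod_(i <- r) u i) `^ l = \prod_(i <- r) u i `^ l.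
Proof.
move=> u0; elim: r => [|i r IH]; first by rewrite !big_nil powR1.
by rewrite !big_cons powRM ?IH// prodr_ge0.
Qed.

End young.

(** * Karamata's inequality for log-concave functions *)

Section karamata.
Context {R : realType}.
Variable f : R -> R.
Hypothesis f_ge0 : forall x, 0 <= x -> 0 <= f x.
Hypothesis f_lc : forall x y l, 0 <= x -> 0 <= y -> 0 < l < 1 ->
  f x `^ l * f y `^ (1 - l) <= f (l * x + (1 - l) * y).

Let F x := ln (f x).
Let slope x y := (F y - F x) / (y - x).

(* Concavity of [F = ln f] at three points; positivity of [f] at the ends
   propagates inside. *)
Let lc3 a b c : 0 <= a -> a < b -> b < c -> 0 < f a -> 0 < f c ->
  0 < f b /\ (c - b) * F a + (b - a) * F c <= (c - a) * F b.
Proof.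
move=> a0 ab bc fa fc.
have ca : 0 < c - a by lra.
pose l := (c - b) / (c - a).
have l01 : 0 < l < 1.
  apply/andP; split; first by rewrite divr_gt0// subr_gt0.
  by rewrite ltr_pdivrMr// mul1r ltrD2l ltrN2.
have c0 : 0 <= c by lra.
have := f_lc a0 c0 l01.
rewrite (_ : l * a + (1 - l) * c = b); last by rewrite /l; field; rewrite gt_eqF.
have p0 : 0 < f a `^ l * f c `^ (1 - l) by rewrite mulr_gt0// powR_gt0.
move=> le; have fb := lt_le_trans p0 le; split=> //.
move: le; rewrite -ler_ln ?posrE// lnM ?posrE ?powR_gt0// !ln_powR => le.
have := ler_wpM2l (ltW ca) le; rewrite -/(F a) -/(F b) -/(F c).
rewrite (_ : (c - a) * (l * F a + (1 - l) * F c) =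
  (c - b) * F a + (b - a) * F c)//.
by rewrite /l; field; rewrite gt_eqF.
Qed.

Let slopeC x y : slope x y = slope y x.
Proof.
rewrite /slope; have [->|xy] := eqVneq x y; first by rewrite !subrr.
have xy1 : x - y != 0 by rewrite subr_eq0.
have yx1 : y - x != 0 by rewrite subr_eq0 eq_sym.
by field; rewrite xy1 yx1.
Qed.

Let slope_lo a b c : 0 <= a -> a <= b -> b < c -> 0 < f a -> 0 < f b -> 0 < f c ->
  slope b c <= slope a c.
Proof.
move=> a0; rewrite le_eqVlt => /predU1P[->//|ab] bc fa fb fc.
have [_ h] := lc3 a0 ab bc fa fc.
rewrite /slope ler_pdivrMr ?subr_gt0// mulrAC ler_pdivlMr ?subr_gt0; nra.
Qed.

Let slope_hi a b c : 0 <= a -> a < b -> b <= c -> 0 < f a -> 0 < f b -> 0 < f c ->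
  slope a c <= slope a b.
Proof.
move=> a0 ab; rewrite le_eqVlt => /predU1P[->//|bc] fa fb fc.
have [_ h] := lc3 a0 ab bc fa fc.
rewrite /slope ler_pdivrMr ?subr_gt0 ?(lt_trans ab)// mulrAC ler_pdivlMr ?subr_gt0; nra.
Qed.

(* The chords of a concave function have slopes that decrease when both ends
   move to the right, in whatever order the ends are. *)
Let slope_mono x y x' y' : 0 <= x' -> 0 <= y' -> x' <= x -> y' <= y ->
  x != y -> x' != y' -> 0 < f x -> 0 < f y -> 0 < f x' -> 0 < f y' ->
  slope x y <= slope x' y'.
Proof.
move=> x'0 y'0 xx yy.
have chain a b a' b' : 0 <= a' -> a' <= a -> b' <= b -> a < b -> a' < b' ->
    0 < f a -> 0 < f b -> 0 < f a' -> 0 < f b' -> slope a b <= slope a' b'.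
  move=> a'0 aa bb ab a'b' fa fb fa' fb'.
  apply: (@le_trans _ _ (slope a' b)); first exact: slope_lo.
  exact: slope_hi.
have chain2 a b a' b' : 0 <= a' -> a' <= a -> b' <= b -> a < b -> b' < a' ->
    0 <= b' -> 0 < f a -> 0 < f b -> 0 < f a' -> 0 < f b' -> slope a b <= slope a' b'.
  move=> a'0 aa bb ab b'a' b'0 fa fb fa' fb'; rewrite (slopeC a').
  by apply: chain => //; lra.
rewrite !neq_lt => /orP[xy|yx] /orP[xy'|yx'] fx fy fx' fy'.
- exact: chain.
- exact: chain2.
- rewrite slopeC [leRHS]slopeC; apply: chain2 => //.
- rewrite slopeC [leRHS]slopeC; exact: chain.
Qed.

(** With [S_k] and [T_k] the k-th partial sums of [y_i - x_i] and of
    [F(y_i) - F(x_i)], the slope [c] of the last nondegenerate chord satisfies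
    [T_k <= c S_k]; this is propagated by Abel summation since [S_k >= 0] and
    slopes increase with the index. At the end [S_n = 0]. *)
Lemma karamata_ln (n : nat) (x y : nat -> R) :
  (forall i, (i < n)%N -> 0 <= x i /\ 0 <= y i) ->
  (forall i, (i < n)%N -> 0 < f (x i) /\ 0 < f (y i)) ->
  (forall i j, (i <= j < n)%N -> x j <= x i /\ y j <= y i) ->
  (forall k, (k <= n)%N -> \sum_(i < k) x i <= \sum_(i < k) y i) ->
  \sum_(i < n) x i = \sum_(i < n) y i ->
  \sum_(i < n) ln (f (y i)) <= \sum_(i < n) ln (f (x i)).
Proof.
move=> xy0 fxy xyi psum sumE.
pose S k := \sum_(i < k) y i - \sum_(i < k) x i.
pose T k := \sum_(i < k) F (y i) - \sum_(i < k) F (x i).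
pose sl i := slope (x i) (y i).
have inv k : (k <= n)%N -> exists c, T k <= c * S k /\
    forall i, (k <= i < n)%N -> x i != y i -> c <= sl i.
  elim: k => [_|k IH kn].
    (* Before the first chord, any lower bound of all the slopes will do. *)
    exists (- \sum_(i < n) `|sl i|); split; first by rewrite /T /S !big_ord0 subr0 mulr0.
    move=> i /= ilt _; rewrite lerNl; apply: le_trans (ler_norm _) _; rewrite normrN.
    by rewrite (bigD1 (Ordinal ilt))//= lerDl sumr_ge0.
  have [c [Tc cs]] := IH (ltnW kn).
  have SS : S k.+1 = S k + (y k - x k) by rewrite /S !big_ord_recr /=; ring.
  have TS : T k.+1 = T k + (F (y k) - F (x k)) by rewrite /T !big_ord_recr /=; ring.
  have [xyk|xyk] := eqVneq (x k) (y k).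
    exists c; split; first by rewrite SS TS xyk !subrr !addr0.
    by move=> i /andP[ki iN]; apply: cs; rewrite iN ltnW.
  exists (sl k); split; last first.
    move=> i /andP[ki iN] xyi'.
    have kin : (k <= i < n)%N by rewrite ltnW.
    have [? ?] := xyi _ _ kin; have [? ?] := xy0 _ iN.
    by have [? ?] := fxy _ iN; have [? ?] := fxy _ kn; exact: slope_mono.
  have ck : c <= sl k by apply: cs; rewrite ?leqnn.
  have S0 : 0 <= S k by rewrite subr_ge0; apply: psum; exact: ltnW.
  rewrite SS TS mulrDr.
  have -> : sl k * (y k - x k) = F (y k) - F (x k).
    by rewrite /sl /slope divfK// subr_eq0 eq_sym.
  by rewrite lerD2r; nra.
have [c [Tc _]] := inv n (leqnn n).
by move: Tc; rewrite /S sumE subrr mulr0 /T subr_le0.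
Qed.

(** The multiplicative form, in which [f] may vanish. *)
Lemma karamata_prod (n : nat) (x y : nat -> R) :
  (forall i, (i < n)%N -> 0 <= x i /\ 0 <= y i) ->
  (forall i j, (i <= j < n)%N -> x j <= x i /\ y j <= y i) ->
  (forall k, (k <= n)%N -> \sum_(i < k) x i <= \sum_(i < k) y i) ->
  \sum_(i < n) x i = \sum_(i < n) y i ->
  \prod_(i < n) f (y i) <= \prod_(i < n) f (x i).
Proof.
case: n => [|n]; first by rewrite !big_ord0.
move=> xy0 xyi psum sumE.
have fx0 i : (i < n.+1)%N -> 0 <= f (x i) by move=> /xy0[? _]; exact: f_ge0.
have fy0 i : (i < n.+1)%N -> 0 <= f (y i) by move=> /xy0[_ ?]; exact: f_ge0.
have [fy|nfy] := pselect (forall i : 'I_n.+1, 0 < f (y i)); last first.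
  have [i fyi] : exists i : 'I_n.+1, f (y i) <= 0.
    apply: contrapT => /forallNP h; apply: nfy => i.
    by rewrite ltNge; apply/negP; exact: h.
  rewrite (bigD1 i)//= (_ : f (y i) = 0) ?mul0r ?prodr_ge0//.
    by move=> j _; exact: fx0.
  by apply/eqP; rewrite eq_le fyi fy0.
have fy' i : (i < n.+1)%N -> 0 < f (y i) by move=> h; exact: (fy (Ordinal h)).
(* The [x i] lie between the extreme values of [y], where [f] is positive. *)
have x0y0 : x 0 <= y 0 by have := psum 1%N isT; rewrite !big_ord1.
have xnyn : y n <= x n.
  by have := psum n (leqnSn n); move: sumE; rewrite !big_ord_recr /=; lra.
have fx i : (i < n.+1)%N -> 0 < f (x i).
  move=> iN; have xi0 : x i <= y 0.
    by apply: le_trans x0y0; have [] := xyi 0%N i iN.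
  have xin : y n <= x i.
    by apply: (le_trans xnyn); have [] := xyi i n; first by rewrite ltnSn andbT.
  have [<-|e0] := eqVneq (y 0) (x i); first exact: fy'.
  have [<-|en] := eqVneq (y n) (x i); first exact: fy'.
  have yn0 : 0 <= y n by have [] := xy0 n (ltnSn n).
  have ynx : y n < x i by rewrite lt_neqAle en.
  have xy0' : x i < y 0 by rewrite lt_neqAle eq_sym e0.
  by have [] := lc3 yn0 ynx xy0' (fy' n (ltnSn n)) (fy' 0%N isT).
rewrite -ler_ln ?posrE; last 2 first.
- by apply: prodr_gt0 => i _; exact: fy.
- by apply: prodr_gt0 => i _; exact: fx.
have ln_prod (u : nat -> R) m : (forall i, (i < m)%N -> 0 < u i) ->
    ln (\prod_(i < m) u i) = \sum_(i < m) ln (u i).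
  elim: m => [|m IH] u0; first by rewrite !big_ord0 ln1.
  rewrite !big_ord_recr /= lnM ?posrE ?IH//.
  - by move=> i im; apply: u0; exact: ltnW.
  - by apply: prodr_gt0 => i _; apply: u0; rewrite ltnS ltnW.
  - exact: u0.
rewrite (ln_prod (f \o y))// (ln_prod (f \o x))//.
apply: karamata_ln => // i iN.
by split; [exact: fx|exact: fy'].
Qed.

End karamata.

(** * Midpoint log-concavity *)

Section midpoint.
Context {R : realType}.

(** Midpoint-closedness and continuity at one point [l] are enough to reach [l]
    by bisection. *)
Lemma bisection_approx (D : R -> R) (l : R) : 0 <= l <= 1 -> 0 <= D 0 -> 0 <= D 1 ->
  (forall a b, 0 <= a <= 1 -> 0 <= b <= 1 -> 0 <= D a -> 0 <= D b ->
     0 <= D ((a + b) / 2)) ->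
  {for l, continuous D} -> 0 <= D l.
Proof.
move=> /andP[l0 l1] D0 D1 mid cD.
have bis k : exists a b, [/\ 0 <= a, b <= 1, a <= l <= b, b - a = (2 ^+ k)^-1 &
    0 <= D a /\ 0 <= D b].
  elim: k => [|k [a [b [a0 b1 /andP[al lb] ab [Da Db]]]]].
    by exists 0, 1; rewrite lexx l0 l1 subr0 expr0 invr1; split.
  have Dm : 0 <= D ((a + b) / 2) by apply: mid => //; apply/andP; split; lra.
  have p0 : 0 < (2 ^+ k : R)^-1 by rewrite invr_gt0 exprn_gt0.
  have [ml|lm] := leP ((a + b) / 2) l.
    exists ((a + b) / 2), b; split => //; [lra|by rewrite ml|].
    by rewrite exprS invfM -ab; field.
  exists a, ((a + b) / 2); split => //; [lra|by rewrite al ltW|].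
  by rewrite exprS invfM -ab; field.
rewrite leNgt; apply/negP => Dl.
have near0 : nbhs l [set x | D x < 0] by exact: (cvgr_lt _ cD _ Dl).
have [e /= e0 near_l] := (@nbhs_ballP R _ l _).1 near0.
have [k hk] : exists k : nat, e^-1 < 2 ^+ k.
  exists (Num.bound e^-1).
  apply: lt_trans (archi_boundP _) _; first by rewrite invr_ge0 ltW.
  by rewrite -natrX ltr_nat ltn_expl.
have [a [b [a0 b1 /andP[al lb] ab [Da Db]]]] := bis k.
have ke : (2 ^+ k)^-1 < e by rewrite invf_plt ?posrE ?exprn_gt0.
have : D a < 0.
  by apply: near_l; rewrite /ball/= ger0_norm; lra.
by rewrite ltNge Da.
Qed.

End midpoint.

(** * Schur concavity and vectors with two nonzero entries *)

Section two_point_vectors.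
Context {R : realType}.

(** The entries of the vector [(a, b, 0, ..)]. *)
Definition two_point (a b : R) (j : nat) : R :=
  if j is 0 then a else if j is 1 then b else 0.

Lemma prod_two_point (f : R -> R) n a b : (1 < n)%N -> f 0 = 1 ->
  \prod_(i < n) f (two_point a b i) = f a * f b.
Proof. by case: n => [|[|n]]// _ f0; rewrite !big_ord_recl big1 ?mulr1. Qed.

Lemma sum_two_point a b k :
  \sum_(0 <= j < k.+2) two_point a b j = a + b.
Proof.
by rewrite big_mkord !big_ord_recl big1 ?addr0.
Qed.

(** A nonincreasing sequence is its own decreasing rearrangement. *)
Lemma decreasing_rearrangement_id n (F : nat -> R) :
  (forall i, F i.+1 <= F i) ->
  decreasing_rearrangement (\row_(i < n) F i) = mkseq F n.
Proof.
move=> dF; rewrite /decreasing_rearrangement.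
rewrite (_ : [seq _ | i <- enum 'I_n] = mkseq F n); last first.
  rewrite /mkseq -val_enum_ord -map_comp; apply: eq_map => i /=.
  by rewrite mxE.
apply: sorted_sort; first by move=> x y z /[swap]; exact: le_trans.
apply/(sortedP 0) => i; rewrite size_mkseq => iN.
by rewrite !nth_mkseq// ltnW.
Qed.

Lemma majorized_two_point n (a b : R) : (1 < n)%N -> 0 <= b -> b <= a ->
  majorized (\row_(i < n) two_point ((a + b) / 2) ((a + b) / 2) i)
            (\row_(i < n) two_point a b i).
Proof.
move=> n1 b0 ba; rewrite /majorized.
rewrite !decreasing_rearrangement_id; last 2 first.
- by move=> [|[|i]]//=; lra.
- by move=> [|[|i]]//=; lra.
have sumE F k : (k <= n)%N ->
    \sum_(0 <= j < k) (mkseq F n)`_j = \sum_(0 <= j < k) F j :> R.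
  by move=> kn; apply: eq_big_nat => j /andP[_ jk]; rewrite nth_mkseq// (leq_trans jk).
split=> [i /andP[i0 iN]|].
  rewrite !sumE ?(ltnW iN)//; case: i i0 iN => [|[|k]]// _ _.
    by rewrite !big_nat1 /=; lra.
  by rewrite !sum_two_point; lra.
rewrite !sumE//; case: n n1 {sumE} => [|[|n]]// _.
by rewrite !sum_two_point; lra.
Qed.

End two_point_vectors.

Section schur.
Context {R : realType}.

Lemma prod_schur_concave (f : R -> R) n (x y : 'rV[R]_n) :
  (forall x, 0 <= x -> 0 <= f x) ->
  (forall x y l, 0 <= x -> 0 <= y -> 0 < l < 1 ->
    f x `^ l * f y `^ (1 - l) <= f (l * x + (1 - l) * y)) ->
  nonneg_orthant n x -> nonneg_orthant n y -> majorized x y ->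
  \prod_i f (y ord0 i) <= \prod_i f (x ord0 i).
Proof.
move=> f0 flc x0 y0 [psum sumE].
have szr (z : 'rV[R]_n) : size (decreasing_rearrangement z) = n.
  by rewrite size_sort size_map size_enum_ord.
have prodE (z : 'rV[R]_n) :
    \prod_i f (z ord0 i) = \prod_(i < n) f (decreasing_rearrangement z)`_i.
  transitivity (\prod_(v <- decreasing_rearrangement z) f v); last first.
    by rewrite (big_nth 0) szr big_mkord.
  rewrite (perm_big [seq z ord0 i | i <- enum 'I_n])/=; last by rewrite perm_sort.
  by rewrite big_map big_enum.
have ge0 (z : 'rV[R]_n) : nonneg_orthant n z -> forall i, (i < n)%N ->
    0 <= (decreasing_rearrangement z)`_i.
  move=> z0 i iN.
  have : (decreasing_rearrangement z)`_i \in decreasing_rearrangement z.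
    by rewrite mem_nth// szr.
  by rewrite mem_sort => /mapP[j _ ->]; exact: z0.
have decr (z : 'rV[R]_n) i j : (i <= j < n)%N ->
    (decreasing_rearrangement z)`_j <= (decreasing_rearrangement z)`_i.
  move=> /andP[ij jn].
  have := @sorted_leq_nth _ (fun a b : R => b <= a) _ _ 0 (decreasing_rearrangement z).
  apply => //; first by move=> a b c /[swap]; exact: le_trans.
  - by apply: sort_sorted => a b; rewrite orbC le_total.
  - by rewrite inE szr (leq_ltn_trans ij).
  - by rewrite inE szr.
rewrite !prodE; apply: karamata_prod => //.
- by move=> i iN; split; apply: ge0.
- by move=> i j ij; split; apply: decr.
- move=> k; rewrite leq_eqVlt => /predU1P[->|kn].
    by move: sumE; rewrite !big_mkord => ->.
  have [->|k0] := posnP k; first by rewrite !big_ord0.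
  by have := psum k; rewrite k0 kn !big_mkord; apply.
- by move: sumE; rewrite !big_mkord.
Qed.

Lemma midpoint_log_concave (f : R -> R) :
  (forall x, 0 <= x -> 0 <= f x) ->
  {within `[0, +oo[, continuous f} ->
  (forall a b, 0 <= b -> b <= a -> f a * f b <= f ((a + b) / 2) ^+ 2) ->
  forall x y l, 0 <= x -> 0 <= y -> 0 < l < 1 ->
    f x `^ l * f y `^ (1 - l) <= f (l * x + (1 - l) * y).
Proof.
move=> f0 cf fmid0 x y l x0 y0 /andP[l0 l1].
have fmid a b : 0 <= a -> 0 <= b -> f a * f b <= f ((a + b) / 2) ^+ 2.
  move=> a0 b0; have [ba|ab] := leP b a; first exact: fmid0.
  by rewrite mulrC addrC; apply: fmid0 => //; exact: ltW.
have p0 : 0 <= l * x + (1 - l) * y.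
  by rewrite addr_ge0// mulr_ge0//; lra.
have [fx0|fx0] := eqVneq (f x) 0.
  by rewrite fx0 powR0 ?gt_eqF// mul0r f0.
have [fy0|fy0] := eqVneq (f y) 0.
  by rewrite fy0 powR0 ?mulr0 ?f0// gt_eqF// subr_gt0.
have fxp : 0 < f x by rewrite lt_neqAle eq_sym fx0 f0.
have fyp : 0 < f y by rewrite lt_neqAle eq_sym fy0 f0.
have [xy|xy] := eqVneq x y.
  rewrite -xy -powRD; last by apply/implyP.
  by rewrite addrC subrK powRr1 ?f0// -mulrDl addrC subrK mul1r.
have powE a k : 0 < a -> a `^ k = expR (k * ln a) by move=> a0; rewrite /powR gt_eqF.
rewrite !powE// -expRD -subr_ge0.
(* [E t] is [f x `^ t * f y `^ (1 - t)]. *)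
pose E t : R := expR (t * ln (f x) + (1 - t) * ln (f y)).
pose p t : R := t * x + (1 - t) * y.
have pge0 t : 0 <= t <= 1 -> 0 <= p t.
  by move=> /andP[? ?]; rewrite addr_ge0// mulr_ge0//; lra.
apply: (@bisection_approx _ (fun t => f (p t) - E t)).
- by rewrite !ltW.
- by rewrite /p /E !mul0r !add0r subr0 !mul1r lnK// subrr.
- by rewrite /p /E subrr !mul0r !addr0 !mul1r lnK// subrr.
- move=> a b a01 b01; rewrite !subr_ge0 => Ea Eb.
  rewrite -(@ler_pXn2r _ 2)// ?nnegrE ?expR_ge0 ?f0//; last first.
    apply: pge0; move: a01 b01 => /andP[? ?] /andP[? ?]; apply/andP; split; lra.
  rewrite (_ : E _ ^+ 2 = E a * E b); last first.
    by rewrite /E expr2 -!expRD; congr expR; field.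
  apply: (@le_trans _ _ (f (p a) * f (p b))).
    by apply: ler_pM => //; exact: expR_ge0.
  rewrite (_ : p ((a + b) / 2) = (p a + p b) / 2); last by rewrite /p; field.
  by apply: fmid; exact: pge0.
- have pl0 : 0 < p l.
    have [x0'|x0'] := eqVneq x 0.
      rewrite /p ltr_wpDl ?mulr_gt0 ?mulr_ge0 ?(ltW l0)//; first by lra.
      by rewrite lt_neqAle -x0' xy x0'.
    rewrite /p ltr_pwDl ?mulr_gt0 ?mulr_ge0//; last by lra.
    by rewrite lt_neqAle eq_sym x0'.
  have cp : {for l, continuous p}.
    apply: continuousD; apply: continuousM => //; try exact: cst_continuous.
    by apply: continuousB => //; exact: cst_continuous.
  apply: continuousB.
    apply: continuous_comp => //.
    have /continuous_within_itvcyP[cin _] := cf.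
    by apply: cin; rewrite in_itv/= andbT.
  apply: continuous_comp; last exact: continuous_expR.
  apply: continuousD; apply: continuousM => //; try exact: cst_continuous.
  by apply: continuousB => //; exact: cst_continuous.
Qed.

End schur.

(** * The Fourier transform of the density *)

Section fourier_density.
Context {R : realType} (d : nat) (mu : probability 'rV[R]_d R) (phi : 'rV[R]_d -> R).
Hypothesis mphi : measurable_fun [set: 'rV[R]_d] phi.
Hypothesis hmu : forall A : set 'rV[R]_d, measurable A ->
  mu A = (\int[lebesgue_rV d]_(x in A) (phi x)%:E)%E.
Hypothesis fourier_ge0 : forall x : 'rV[R]_d, 0 <= fourier phi x.

Lemma bdm_cos_inner (s : 'rV[R]_d) : bdm (fun x : 'rV[R]_d => cos (inner s x)).
Proof.
split; last by exists 1 => x; exact: cos_max.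
by apply: continuous_rV_measurable; exact: continuous_cos_inner.
Qed.

Lemma bdm_sin_inner (s : 'rV[R]_d) : bdm (fun x : 'rV[R]_d => sin (inner s x)).
Proof.
split; last by exists 1 => x; exact: sin_max.
apply: continuous_rV_measurable => x.
by apply: continuous_comp; [exact: continuous_inner|exact: continuous_sin].
Qed.

Lemma Re_fourier_density (s : 'rV[R]_d) :
  complex.Re (fourier phi s) = mean mu (fun x => cos (inner ((2 * pi) *: s) x)).
Proof.
rewrite -(mean_density mphi hmu (bdm_cos_inner _)) /=.
apply: eq_Rintegral => x _ /=.
by rewrite cosN innerZl mul0r subr0.
Qed.

(** Nonnegativity of a complex number includes that it is real. *)
Lemma mean_sin_density (s : 'rV[R]_d) : mean mu (fun x => sin (inner s x)) = 0.
Proof.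
have pi2 : 2 * pi != 0 :> R by rewrite mulf_neq0// gt_eqF// pi_gt0.
have := fourier_ge0 ((- (2 * pi)^-1) *: s); rewrite lecE => /andP[/eqP + _].
rewrite /fourier /cintegral /= => <-.
rewrite -(mean_density mphi hmu (bdm_sin_inner _)).
apply: eq_Rintegral => x _ /=.
rewrite mul0r addr0 innerZl; congr (_ * sin _).
by move: pi2; move: (2 * pi) => c c0; field.
Qed.

Lemma fourier_ray_mean q (t : 'rV[R]_d) r :
  fourier_ray q phi t r =
    mean mu (fun x => cos (inner ((r `^ q^-1) *: ((2 * pi) *: t)) x)).
Proof.
rewrite /fourier_ray Re_fourier_density (_ : _ *: (_ *: t) = r `^ q^-1 *: ((2 * pi) *: t))//.
by rewrite !scalerA; congr (_ *: _); rewrite mulrC.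
Qed.

Lemma fourier_ray_ge0 q (t : 'rV[R]_d) r : 0 <= fourier_ray q phi t r.
Proof.
by have := fourier_ge0 ((r `^ q^-1) *: t); rewrite lecE => /andP[].
Qed.

Lemma fourier_ray0 q (t : 'rV[R]_d) : 0 < q -> fourier_ray q phi t 0 = 1.
Proof.
move=> q0; rewrite fourier_ray_mean powR0 ?invr_eq0 ?gt_eqF// scale0r.
by under eq_fun do rewrite inner0l cos0; rewrite mean_cst.
Qed.

End fourier_density.

(** * The functional associated to a positive definite function *)

Section functional.
Context {R : realType} (d : nat) (q : R) (mu : probability 'rV[R]_d R)
  (phi : 'rV[R]_d -> R).
Hypothesis q0 : 0 < q.
Hypothesis mphi : measurable_fun [set: 'rV[R]_d] phi.
Hypothesis hmu : forall A : set 'rV[R]_d, measurable A ->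
  mu A = (\int[lebesgue_rV d]_(x in A) (phi x)%:E)%E.
Hypothesis fourier_ge0 : forall x : 'rV[R]_d, 0 <= fourier phi x.
Context (n : nat) dT (T : measurableType dT) (P : probability T R)
  (X : 'I_n -> {RV P >-> 'rV[R]_d}).
Hypothesis hX : iid_with_law X mu.

Let u t r := fourier_ray q phi t r.
Let U t (a : 'rV[R]_n) := \prod_i u t (a ord0 i).
Let Y (a : 'rV[R]_n) w := \sum_(i < n) (a ord0 i `^ q^-1) *: X i w.
Let H h a := mean P (fun w => h (Y a w)).

Let mY a : measurable_fun setT (Y a).
Proof.
apply: measurable_fun_coordP => i j.
under eq_fun do rewrite summxE.
apply: measurable_sum => k.
under eq_fun do rewrite mxE.
apply: measurable_funM; first exact: measurable_cst.
exact: (measurableT_comp (@measurable_coord R 1 d i j) (measurable_funPT (X k))).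
Qed.

Let mean_trig a s :
  mean P (fun w => cos (inner s (Y a w))) = U ((2 * pi)^-1 *: s) a /\
  mean P (fun w => sin (inner s (Y a w))) = 0.
Proof.
have pi2 : 2 * pi != 0 :> R by rewrite mulf_neq0// gt_eqF// pi_gt0.
have [indX lawX] := hX.
pose th i x : R := inner ((a ord0 i `^ q^-1) *: s) x.
have YE w : inner s (Y a w) = \sum_i th i (X i w).
  by rewrite inner_sumr; apply: eq_bigr => i _; rewrite innerZr /th innerZl.
have mth i : measurable_fun setT (th i).
  by apply: continuous_rV_measurable; exact: continuous_inner.
have msin i : mean P (fun w => sin (th i (X i w))) = 0.
  rewrite (mean_law (lawX i) (bdm_sin_inner _)).
  exact: (mean_sin_density mphi hmu fourier_ge0).
have [cosE sinE] := mean_cos_sum_independent indX mth msin.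
split; last by under eq_fun do rewrite YE.
under eq_fun do rewrite YE.
rewrite cosE; apply: eq_bigr => i _.
rewrite (mean_law (lawX i) (bdm_cos_inner _)) /u (fourier_ray_mean mphi hmu).
by rewrite [_ *: (_^-1 *: s)]scalerA mulfV// scale1r.
Qed.

Let functionalE h a : continuous h -> positive_definite h ->
  associated_functional q X h a = (H h a)%:E.
Proof.
move=> ch hpd; rewrite /associated_functional expectation_mean//.
apply: (bdm_comp (mY a)); split; first exact: continuous_rV_measurable.
by exists (h 0) => x; exact: positive_definite_le0.
Qed.

(* Linear inequalities between the products [U t a], for all [t], pass to the
   functionals; three vectors are enough for all the uses. *)
Let combination_ge0 h (c1 c2 c3 : R) a1 a2 a3 :
  continuous h -> positive_definite h ->
  (forall t, 0 <= c1 * U t a1 + c2 * U t a2 + c3 * U t a3) ->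
  0 <= c1 * H h a1 + c2 * H h a2 + c3 * H h a3.
Proof.
move=> ch hpd U0.
have sum3 (F : 'I_3 -> R) : \sum_i F i = F 0 + F 1 + F 2%:R.
  rewrite !big_ord_recl big_ord0 addr0 addrA; congr (_ + F _ + F _); exact: val_inj.
have := @mean_positive_definite_ge0 R d dT T P 'I_3 (fun i => nth 0 [:: c1; c2; c3] i)
  (fun i => Y (nth 0 [:: a1; a2; a3] i)) (fun i => mY _) _ _ h ch hpd.
rewrite sum3 /=; apply.
- by move=> s; rewrite sum3 /= !(mean_trig _ s).1.
- by move=> s i; rewrite (mean_trig _ s).2.
Qed.

Let U_ge0 t a : 0 <= U t a.
Proof. by apply: prodr_ge0 => i _; exact: fourier_ray_ge0. Qed.

Lemma associated_functional_ge0 h a : continuous h -> positive_definite h ->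
  (0 <= associated_functional q X h a)%E.
Proof.
move=> ch hpd; rewrite functionalE// lee_fin.
have := @combination_ge0 h 1 0 0 a a a ch hpd.
rewrite !mul0r !addr0 !mul1r; apply => t.
by rewrite !mul0r !addr0 mul1r.
Qed.

Let ray_log_convexP t :
  log_convex (V := R^o) `[0, +oo[ (fun r => (u t r)%:E) <->
  forall x y l, 0 <= x -> 0 <= y -> 0 < l < 1 ->
    u t (l * x + (1 - l) * y) <= u t x `^ l * u t y `^ (1 - l).
Proof.
split=> [[_ lc] x y l x0 y0 l01|lc].
  have := lc x y l; rewrite /= !in_itv/= !andbT => /(_ x0 y0 l01).
  by rewrite -EFinM lee_fin.
split=> [x _|x y l]; first by rewrite lee_fin; exact: fourier_ray_ge0.
rewrite /= !in_itv/= !andbT => x0 y0 l01.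
by rewrite -EFinM lee_fin; exact: lc.
Qed.

Let ray_log_concaveP t :
  log_concave (V := R^o) `[0, +oo[ (fun r => (u t r)%:E) <->
  forall x y l, 0 <= x -> 0 <= y -> 0 < l < 1 ->
    u t x `^ l * u t y `^ (1 - l) <= u t (l * x + (1 - l) * y).
Proof.
split=> [[_ lc] x y l x0 y0 l01|lc].
  have := lc x y l; rewrite /= !in_itv/= !andbT => /(_ x0 y0 l01).
  by rewrite -EFinM lee_fin.
split=> [x _|x y l]; first by rewrite lee_fin; exact: fourier_ray_ge0.
rewrite /= !in_itv/= !andbT => x0 y0 l01.
by rewrite -EFinM lee_fin; exact: lc.
Qed.

Lemma associated_functional_log_convex h :
  continuous h -> positive_definite h ->
  (forall t, log_convex (V := R^o) `[0, +oo[ (fun r => (fourier_ray q phi t r)%:E)) ->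
  log_convex (nonneg_orthant n) (associated_functional q X h).
Proof.
move=> ch hpd lc; split=> [a _|x y l x0 y0 l01]; first exact: associated_functional_ge0.
have H0 a : 0 <= H h a by have := associated_functional_ge0 a ch hpd; rewrite functionalE.
rewrite !functionalE// !poweR_EFin -EFinM lee_fin.
have [l0 l1] := andP l01.
apply: young_inf => // s1 s2 s10 s20 s12.
have := @combination_ge0 h (l * s1) ((1 - l) * s2) (-1) x y (l *: x + (1 - l) *: y) ch hpd.
rewrite !mulN1r subr_ge0; apply => t; rewrite mulN1r subr_ge0.
apply: le_trans (weighted_young (U_ge0 t x) (U_ge0 t y) l01 s10 s20 s12).
have powU z k : U t z `^ k = \prod_i u t (z ord0 i) `^ k.
  by apply: powR_prod => i; exact: fourier_ray_ge0.
have UU : U t x `^ l * U t y `^ (1 - l) =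
    \prod_i (u t (x ord0 i) `^ l * u t (y ord0 i) `^ (1 - l)).
  by rewrite big_split; congr (_ * _); exact: powU.
apply: le_trans (_ : _ <= \prod_i (u t (x ord0 i) `^ l * u t (y ord0 i) `^ (1 - l))) _.
  apply: ler_prod => i _; apply/andP; split; first exact: fourier_ray_ge0.
  have /ray_log_convexP lct := lc t.
  by rewrite !mxE; apply: lct.
by rewrite UU.
Qed.

Lemma associated_functional_schur_concave h :
  continuous h -> positive_definite h ->
  (forall t, log_concave (V := R^o) `[0, +oo[ (fun r => (fourier_ray q phi t r)%:E)) ->
  schur_concave (nonneg_orthant n) (associated_functional q X h).
Proof.
move=> ch hpd lc x y x0 y0 xy; rewrite !functionalE// lee_fin.
have := @combination_ge0 h 1 (-1) 0 x y x ch hpd.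
rewrite !mul0r !addr0 !mul1r !mulN1r subr_ge0; apply => t.
rewrite mul0r addr0 mul1r mulN1r subr_ge0.
have /ray_log_concaveP lct := lc t.
by apply: prod_schur_concave => // r _; exact: fourier_ray_ge0.
Qed.

Let functional_cosE t a :
  associated_functional q X (fun x => cos (inner ((2 * pi) *: t) x)) a = (U t a)%:E.
Proof.
have pi2 : 2 * pi != 0 :> R by rewrite mulf_neq0// gt_eqF// pi_gt0.
rewrite functionalE; [|exact: continuous_cos_inner|exact: positive_definite_cos].
by rewrite /H (mean_trig _ _).1 scalerA mulVf// scale1r.
Qed.

Lemma fourier_ray_log_convex : (0 < n)%N ->
  (forall g : 'rV[R]_d -> R, continuous g -> positive_definite g ->
    log_convex (nonneg_orthant n) (associated_functional q X g)) ->
  forall t, log_convex (V := R^o) `[0, +oo[ (fun r => (fourier_ray q phi t r)%:E).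
Proof.
move=> n0 lcX t; apply/ray_log_convexP => x y l x0 y0 l01.
pose v r : 'rV[R]_n := \row_i (if i == Ordinal n0 then r else 0).
have v0 r : 0 <= r -> nonneg_orthant n (v r).
  by move=> r0 i; rewrite mxE; case: ifP.
have Uv r : U t (v r) = u t r.
  rewrite /U (bigD1 (Ordinal n0))//= mxE eqxx big1 ?mulr1// => i /negbTE i0.
  by rewrite mxE i0 /u (fourier_ray0 mphi hmu).
have [_ /(_ _ _ _ (v0 _ x0) (v0 _ y0) l01)] := lcX _
  (@continuous_cos_inner R d ((2 * pi) *: t)) (positive_definite_cos ((2 * pi) *: t)).
rewrite (_ : l *: v x + (1 - l) *: v y = v (l * x + (1 - l) * y)); last first.
  by apply/rowP => i; rewrite !mxE; case: ifP => // _; rewrite !mulr0 addr0.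
rewrite (functional_cosE t (v x)) (functional_cosE t (v y)) functional_cosE.
by rewrite (Uv x) (Uv y) Uv.
Qed.

Lemma fourier_ray_log_concave : (1 < n)%N ->
  (forall g : 'rV[R]_d -> R, continuous g -> positive_definite g ->
    schur_concave (nonneg_orthant n) (associated_functional q X g)) ->
  (forall t : 'rV[R]_d, {within `[0, +oo[, continuous (fourier_ray q phi t)}) ->
  forall t, log_concave (V := R^o) `[0, +oo[ (fun r => (fourier_ray q phi t r)%:E).
Proof.
move=> n1 scX cray t; apply/ray_log_concaveP; apply: midpoint_log_concave.
- by move=> r _; exact: fourier_ray_ge0.
- exact: cray.
move=> a b b0 ba.
pose v a b : 'rV[R]_n := \row_(i < n) two_point a b i.
have v0 a' b' : 0 <= a' -> 0 <= b' -> nonneg_orthant n (v a' b').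
  by move=> a0' b0' i; rewrite mxE /two_point; case: (nat_of_ord i) => [|[|]].
have Uv a' b' : U t (v a' b') = u t a' * u t b'.
  transitivity (\prod_(i < n) u t (two_point a' b' i)).
    by apply: eq_bigr => i _; rewrite mxE.
  by apply: prod_two_point => //; exact: (fourier_ray0 mphi hmu).
have a0 : 0 <= a by lra.
have m0 : 0 <= (a + b) / 2 by lra.
have := scX _ (@continuous_cos_inner R d ((2 * pi) *: t))
  (positive_definite_cos ((2 * pi) *: t)) _ _ (v0 _ _ m0 m0) (v0 _ _ a0 b0)
  (majorized_two_point n1 b0 ba).
rewrite (functional_cosE t (v a b)) functional_cosE lee_fin.
by rewrite (Uv a b) Uv expr2.
Qed.

End functional.

Theorem theorem3p3 (R : realType) (d : nat) (hd : (0 < d)%N)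
    (q : R) (hq : 0 < q)
    (mu : probability 'rV[R]_d R) (phi : 'rV[R]_d -> R)
    (hphi_meas : measurable_fun [set: 'rV[R]_d] phi)
    (hmu : forall A : set 'rV[R]_d, measurable A ->
       mu A = (\int[lebesgue_rV d]_(x in A) (phi x)%:E)%E)
    (hphi_even : forall x : 'rV[R]_d, phi (- x) = phi x)
    (hphi_hat_pos : forall x : 'rV[R]_d, 0 <= fourier phi x)
    (hphi_hat_int : (lebesgue_rV d).-integrable [set: 'rV[R]_d]
       (fun x => (complex.Re (fourier phi x))%:E))
    (h : 'rV[R]_d -> R) (hh_cont : continuous h)
    (hh_pd : positive_definite h)
    (n : nat) (hn : (0 < n)%N)
    (dT : measure_display) (T : measurableType dT) (P : probability T R)
    (X : 'I_n -> {RV P >-> 'rV[R]_d}) (hX : iid_with_law X mu) :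
  [/\ forall a : 'rV[R]_n, nonneg_orthant n a -> (0 <= associated_functional q X h a)%E,
   ((forall t : 'rV[R]_d,
       log_convex (V := R^o) `[0, +oo[ (fun r => (fourier_ray q phi t r)%:E)) ->
      log_convex (nonneg_orthant n) (associated_functional q X h))
   /\
   ((forall g : 'rV[R]_d -> R, continuous g -> positive_definite g ->
       log_convex (nonneg_orthant n) (associated_functional q X g)) ->
      forall t : 'rV[R]_d,
        log_convex (V := R^o) `[0, +oo[ (fun r => (fourier_ray q phi t r)%:E))
  & ((forall t : 'rV[R]_d,
       log_concave (V := R^o) `[0, +oo[ (fun r => (fourier_ray q phi t r)%:E)) ->
      schur_concave (nonneg_orthant n) (associated_functional q X h))
   /\
   ((1 < n)%N ->
     (forall g : 'rV[R]_d -> R, continuous g -> positive_definite g ->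
       schur_concave (nonneg_orthant n) (associated_functional q X g)) ->
     (forall t : 'rV[R]_d, {within `[0, +oo[, continuous (fourier_ray q phi t)}) ->
      forall t : 'rV[R]_d,
        log_concave (V := R^o) `[0, +oo[ (fun r => (fourier_ray q phi t r)%:E))].
Proof.
split.
- by move=> a _; exact: (associated_functional_ge0 q hphi_meas hmu hphi_hat_pos hX).
- split; first exact: (associated_functional_log_convex hphi_meas hmu hphi_hat_pos hX).
  exact: (fourier_ray_log_convex hq hphi_meas hmu hphi_hat_pos hX hn).
- split; first exact: (associated_functional_schur_concave hphi_meas hmu hphi_hat_pos hX).
  move=> n1.
  exact: (fourier_ray_log_concave hq hphi_meas hmu hphi_hat_pos hX n1).
Qed.
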